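(* Let $G$ be a tree-cograph and let $T$ be a decomposition tree for $G$. Then the maximum number of edges in an induced matching in $G$ can be computed in linear time (given $G$ and $T$ as input).
   Context: Tree-cographs are defined recursively: (1) every tree is a tree-cograph; (2) if $G$ is a tree-cograph then its complement $\bar G$ is a tree-cograph; (3) for $k\ge 2$, if $G_1,\dots,G_k$ are connected tree-cographs then their disjoint union is a tree-cograph. A decomposition tree for a tree-cograph $G$ is a rooted binary tree in which each internal node (including the root) is labeled as a join node or a union node, each leaf is labeled by a tree or the complement of a tree, and $G$ is obtained by evaluating the tree: a union node yields the disjoint union of the graphs of its two children, and a join node yields the disjoint union of the graphs of its two children plus all edges between them. An induced matching in a graph $G$ is a set of edges no two of which share a common vertex or are joined by an edge of $G$. *)

(* Defs.v *)
From mathcomp Require Import all_boot.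
Set Implicit Arguments. Unset Strict Implicit. Unset Printing Implicit Defensive.

(* Finite simple graphs.  A graph is a pair (n, e): vertex set {0..n-1}
   and e : rel nat; the (simple, undirected, loopless) adjacency is sg n e. *)
Definition sg (n : nat) (e : rel nat) (u v : nat) : bool :=
  [&& u < n, v < n, u != v, e u v & e v u].

Definition compl (e : rel nat) : rel nat := fun u v => ~~ (e u v && e v u).

Definition connected (n : nat) (e : rel nat) : Prop :=
  0 < n /\ forall u v, u < n -> v < n ->
    exists p : seq nat, path (sg n e) u p /\ last u p = v.

Definition nedges (n : nat) (e : rel nat) : nat :=
  \sum_(u < n) \sum_(v < n) ((u < v) && sg n e u v).

Definition is_tree (n : nat) (e : rel nat) : Prop :=
  connected n e /\ nedges n e = n.-1.

(* disjoint union of the k graphs (ns i, es i), i < k; block i occupies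
   the vertices off i, ..., off i + ns i - 1 *)
Definition off (ns : nat -> nat) (i : nat) : nat := \sum_(j < i) ns j.
Definition dsum (k : nat) (ns : nat -> nat) : nat := off ns k.
Definition dunion (k : nat) (ns : nat -> nat) (es : nat -> rel nat) : rel nat :=
  fun u v => [exists i : 'I_k,
     [&& off ns i <= u, u < off ns i + ns i, off ns i <= v, v < off ns i + ns i
       & es i (u - off ns i) (v - off ns i)]].

Inductive tree_cograph : nat -> rel nat -> Prop :=
| tc_tree n e : is_tree n e -> tree_cograph n e
| tc_compl n e : tree_cograph n e -> tree_cograph n (compl e)
| tc_union k ns es : 2 <= k ->
    (forall i, i < k -> tree_cograph (ns i) (es i) /\ connected (ns i) (es i)) ->
    tree_cograph (dsum k ns) (dunion k ns es)
| tc_iso n e e' (f : nat -> nat) : tree_cograph n e ->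
    (forall u, u < n -> f u < n) -> {in gtn n &, injective f} ->
    (forall u v, u < n -> v < n -> sg n e' u v = sg n e (f u) (f v)) ->
    tree_cograph n e'.

(* Decomposition trees.  A leaf records whether it is a tree (co = false)
   or the complement of a tree (co = true), and its vertex set S. *)
Inductive dtree : Type :=
| DLeaf (co : bool) (Sv : seq nat)
| DUnion (l r : dtree)
| DJoin (l r : dtree).

Fixpoint dverts (T : dtree) : seq nat :=
  match T with
  | DLeaf _ Sv => Sv
  | DUnion l r => dverts l ++ dverts r
  | DJoin l r => dverts l ++ dverts r
  end.

Definition induced (n : nat) (e : rel nat) (Sv : seq nat) : rel nat :=
  fun i j => sg n e (nth 0 Sv i) (nth 0 Sv j).

Fixpoint dtree_ok (n : nat) (e : rel nat) (T : dtree) : Prop :=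
  match T with
  | DLeaf false Sv => is_tree (size Sv) (induced n e Sv)
  | DLeaf true Sv => is_tree (size Sv) (compl (induced n e Sv))
  | DUnion l r => dtree_ok n e l /\ dtree_ok n e r /\
      (forall u v, u \in dverts l -> v \in dverts r -> ~~ sg n e u v)
  | DJoin l r => dtree_ok n e l /\ dtree_ok n e r /\
      (forall u v, u \in dverts l -> v \in dverts r -> sg n e u v)
  end.

Definition decomposition_tree (n : nat) (e : rel nat) (T : dtree) : Prop :=
  perm_eq (dverts T) (iota 0 n) /\ dtree_ok n e T.

Definition induced_matching (n : nat) (e : rel nat) (M : seq (nat * nat)) : bool :=
  all (fun p => sg n e p.1 p.2) M &&
  pairwise (fun p q => all (fun x => all (fun y => (x != y) && ~~ sg n e x y)
                                         [:: q.1; q.2]) [:: p.1; p.2]) M.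

Definition max_induced_matching (n : nat) (e : rel nat) (k : nat) : Prop :=
  (exists M, induced_matching n e M /\ size M = k) /\
  (forall M, induced_matching n e M -> size M <= k).

(* Model of computation: unit-cost RAM (registers = memory cells indexed
   by nat, unbounded nat contents, indirect addressing). *)
Inductive instr : Type :=
| IConst (r k : nat)
| IAdd (r a b : nat)
| ISub (r a b : nat)
| ILoad (r a : nat)
| IStore (a b : nat)
| IJz (a l : nat)
| IJmp (l : nat)
| IHalt.

Definition config := (nat * (nat -> nat))%type.

Definition upd (m : nat -> nat) (a v : nat) : nat -> nat :=
  fun x => if x == a then v else m x.

Definition step (P : seq instr) (c : config) : config :=
  let: (pc, m) := c in
  match nth IHalt P pc with
  | IConst r k => (pc.+1, upd m r k)
  | IAdd r a b => (pc.+1, upd m r (m a + m b))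
  | ISub r a b => (pc.+1, upd m r (m a - m b))
  | ILoad r a => (pc.+1, upd m r (m (m a)))
  | IStore a b => (pc.+1, upd m (m a) (m b))
  | IJz a l => (if m a == 0 then l else pc.+1, m)
  | IJmp l => (l, m)
  | IHalt => (pc, m)
  end.

Definition halted (P : seq instr) (c : config) : bool :=
  if nth IHalt P c.1 is IHalt then true else false.

Definition init (input : seq nat) : config :=
  (0, fun a => if a == 0 then size input else nth 0 input a.-1).

Definition runs_to (P : seq instr) (input : seq nat) (t out : nat) : Prop :=
  let c := iter t (step P) (init input) in
  halted P c /\ c.2 0 = out /\
  (forall s, s < t -> ~~ halted P (iter s (step P) (init input))).

Definition edge_list (n : nat) (e : rel nat) : seq (nat * nat) :=
  [seq p <- [seq (u, v) | u <- iota 0 n, v <- iota 0 n] | (p.1 < p.2) && sg n e p.1 p.2].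

Definition enc_graph (n : nat) (e : rel nat) : seq nat :=
  n :: size (edge_list n e) :: flatten [seq [:: p.1; p.2] | p <- edge_list n e].

Fixpoint enc_tree (T : dtree) : seq nat :=
  match T with
  | DLeaf co Sv => (if co then 3 else 2) :: size Sv :: Sv
  | DUnion l r => 0 :: enc_tree l ++ enc_tree r
  | DJoin l r => 1 :: enc_tree l ++ enc_tree r
  end.

Definition encode (n : nat) (e : rel nat) (T : dtree) : seq nat :=
  enc_graph n e ++ enc_tree T.

(* Main.v *)
Require Import Defs.
From mathcomp Require Import all_boot.
From mathcomp Require Import zify.
Set Implicit Arguments. Unset Strict Implicit. Unset Printing Implicit Defensive.

(** The maximum induced matching number is additive over disjoint unions; for
    a join it is max(1, left, right), since two edges of an induced matching of
    a join lie on the same side; for the complement of a tree it is at most 1,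
    since two edges would give a 4-cycle in the tree.  In a tree, remove leaves
    one at a time, each becoming a child of its last neighbour, and mark a
    vertex if none of its children is marked and some child has no marked
    child.  Matching each marked vertex to such a child gives an induced
    matching, and every edge can be charged to a marked vertex so that edges
    with the same charge conflict; hence the number of marked vertices is the
    optimum.

    For linear time, only the degree and the sum of the remaining neighbours
    of each vertex are stored: the neighbour of a leaf is then that sum, so no
    adjacency lists are needed.  All trees of the decomposition are treated at
    once, and the preorder list of nodes is evaluated from right to left with a
    stack. *)

(** * Structured programs on the RAM *)

(** A tree is used only through a rank function, the distance to vertex 0 ([treelike]): no vertex
    has two neighbours of rank at most its own. A vertex of largest rank on a cycle would violate
    this, which excludes the triangles and 4-cycles that matter for complements of trees. Among the
    vertices that still have an edge, one of largest rank has degree one, so the removal of leaves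
    cannot stall. Neither acyclicity nor subtrees have to be formalised.

    All trees can be treated at once because a vertex carries the number of its leaf as a label,
    with 0 for complements: the edges whose ends have equal nonzero labels are exactly the edges of
    the trees.

    Removal takes linear time because only the degree of the neighbour drops, and that neighbour is
    examined next even if the scan has already passed it. Children are attached only to vertices not
    yet removed, so the flags of a vertex are final when it is removed and can be passed on at that
    moment. *)

Definition runs (P : seq instr) (t : nat) (c c' : config) : Prop :=
  iter t (step P) c = c' /\
  forall s, s < t -> ~~ halted P (iter s (step P) c).

Lemma runs_trans P t1 t2 c1 c2 c3 :
  runs P t1 c1 c2 -> runs P t2 c2 c3 -> runs P (t1 + t2) c1 c3.
Proof.
move=> [E1 H1] [E2 H2]; split; first by rewrite addnC iterD E1.
move=> s Hs; case: (ltnP s t1) => [/H1 //|Hts].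
by rewrite -(subnK Hts) iterD E1; apply: H2; rewrite ltn_subLR.
Qed.

Lemma runs1 P c : ~~ halted P c -> runs P 1 c (step P c).
Proof. by move=> H; split=> // -[]. Qed.

Definition code_at (P : seq instr) (pc : nat) (l : seq instr) : Prop :=
  forall i, i < size l -> nth IHalt P (pc + i) = nth IHalt l i.

Lemma code_at_cat P pc l1 l2 : code_at P pc (l1 ++ l2) ->
  code_at P pc l1 /\ code_at P (pc + size l1) l2.
Proof.
move=> H; split=> i Hi.
  by rewrite H ?nth_cat ?Hi // size_cat ltn_addr.
rewrite -addnA H; last by rewrite size_cat ltn_add2l.
by rewrite nth_cat ltnNge leq_addr /= addKn.
Qed.

Lemma code_at_cons P pc i l : code_at P pc (i :: l) ->
  nth IHalt P pc = i /\ code_at P pc.+1 l.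
Proof.
rewrite -cat1s => /code_at_cat [H1 H2]; split; last by rewrite addn1 in H2.
by have := H1 0 isT; rewrite addn0.
Qed.

Definition straight (i : instr) : bool :=
  match i with IJz _ _ | IJmp _ | IHalt => false | _ => true end.

Definition exec1 (m : nat -> nat) (i : instr) : nat -> nat :=
  match i with
  | IConst r k => upd m r k
  | IAdd r a b => upd m r (m a + m b)
  | ISub r a b => upd m r (m a - m b)
  | ILoad r a => upd m r (m (m a))
  | IStore a b => upd m (m a) (m b)
  | _ => m
  end.

Lemma runs_straight P l pc m : code_at P pc l -> all straight l ->
  runs P (size l) (pc, m) (pc + size l, foldl exec1 m l).
Proof.
elim: l pc m => [|i l IH] pc m /=; first by rewrite addn0.
move=> /code_at_cons [Hi Hl] /andP[si sl].
have R1 : runs P 1 (pc, m) (pc.+1, exec1 m i).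
  have <- : step P (pc, m) = (pc.+1, exec1 m i).
    by rewrite /step Hi; case: (i) si.
  by apply: runs1; rewrite /halted /= Hi; case: (i) si.
by rewrite addnS -addSn; apply: runs_trans R1 (IH _ _ Hl sl).
Qed.

Lemma runs_jz P pc m a l : nth IHalt P pc = IJz a l ->
  runs P 1 (pc, m) ((if m a == 0 then l else pc.+1), m).
Proof.
move=> H; have <- : step P (pc, m) = ((if m a == 0 then l else pc.+1), m).
  by rewrite /step H.
by apply: runs1; rewrite /halted /= H.
Qed.

Lemma runs_jmp P pc m l : nth IHalt P pc = IJmp l -> runs P 1 (pc, m) (l, m).
Proof.
move=> H; have <- : step P (pc, m) = (l, m) by rewrite /step H.
by apply: runs1; rewrite /halted /= H.
Qed.

(** * Loop-free commands on registers and arrays, and their compilation *)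

Record state := State { rg : nat -> nat; ar : nat -> nat -> nat }.

Inductive hcmd : Type :=
| HSkip
| HConst (r k : nat)
| HAdd (r a b : nat)
| HSub (r a b : nat)
| HLoad (r j a : nat)
| HStore (j a b : nat)
| HIf (a : nat) (c d : hcmd)
| HSeq (c d : hcmd).

(* Nat.eqb rather than ==, so that the tactic run below can compute updates. *)
Definition setr (s : state) (r v : nat) : state :=
  State (fun r' => if Nat.eqb r' r then v else rg s r') (ar s).
Definition seta (s : state) (j i v : nat) : state :=
  State (rg s) (fun j' => if Nat.eqb j' j then upd (ar s j) i v else ar s j').

Lemma eqb_eqn a b : Nat.eqb a b = (a == b).
Proof. by elim: a b => [|a IH] [|b] //=; rewrite IH. Qed.

Fixpoint eval (c : hcmd) (s : state) : state :=
  match c with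
  | HSkip => s
  | HConst r k => setr s r k
  | HAdd r a b => setr s r (rg s a + rg s b)
  | HSub r a b => setr s r (rg s a - rg s b)
  | HLoad r j a => setr s r (ar s j (rg s a))
  | HStore j a b => seta s j (rg s a) (rg s b)
  | HIf a c d => if rg s a == 0 then eval c s else eval d s
  | HSeq c d => eval d (eval c s)
  end.

Definition nregs := 16.

Fixpoint wf (c : hcmd) : bool :=
  match c with
  | HSkip => true
  | HConst r _ => r < nregs
  | HAdd r a b | HSub r a b => [&& r < nregs, a < nregs & b < nregs]
  | HLoad r j a => [&& r < nregs, j < 8 & a < nregs]
  | HStore j a b => [&& j < 8, a < nregs & b < nregs]
  | HIf a c d => [&& a < nregs, wf c & wf d]
  | HSeq c d => wf c && wf d
  end.

Definition loc (r : nat) : nat := r + 4.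

Definition address (j a : nat) : seq instr :=
  [:: IAdd 1 (loc a) (loc a); IAdd 1 1 1; IAdd 1 1 1; IAdd 1 1 0;
      IConst 2 j; IAdd 1 1 2].

(** The branch for a nonzero test comes first, so that [IJz] jumps over it. Jump targets are
    absolute, hence the argument [pc]. *)
Fixpoint compile (c : hcmd) (pc : nat) : seq instr :=
  match c with
  | HSkip => [::]
  | HConst r k => [:: IConst (loc r) k]
  | HAdd r a b => [:: IAdd (loc r) (loc a) (loc b)]
  | HSub r a b => [:: ISub (loc r) (loc a) (loc b)]
  | HLoad r j a => rcons (address j a) (ILoad (loc r) 1)
  | HStore j a b => rcons (address j a) (IStore 1 (loc b))
  | HIf a c d =>
      let cd := compile d pc.+1 in
      let pc1 := pc.+1 + size cd in
      let cc := compile c pc1.+1 in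
      IJz (loc a) pc1.+1 :: cd ++ IJmp (pc1.+1 + size cc) :: cc
  | HSeq c d =>
      let cc := compile c pc in cc ++ compile d (pc + size cc)
  end.

Fixpoint csize (c : hcmd) : nat :=
  match c with
  | HSkip => 0
  | HConst _ _ | HAdd _ _ _ | HSub _ _ _ => 1
  | HLoad _ _ _ | HStore _ _ _ => 7
  | HIf _ c d => (csize d + (csize c).+1).+1
  | HSeq c d => csize c + csize d
  end.

Lemma size_compile c pc : size (compile c pc) = csize c.
Proof.
by elim: c pc => //= [a c IHc d IHd|c IHc d IHd] pc; rewrite size_cat /= ?IHc ?IHd.
Qed.

(* Registers live in cells 4 .. 19, cell 0 holds the base address X of the
   arrays, cells 1 and 2 are scratch and cell 3 is the loop counter; the
   eight arrays are interleaved, so they are all unbounded. *)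
Definition rep (X : nat) (m : nat -> nat) (s : state) : Prop :=
  [/\ m 0 = X, forall r, r < nregs -> m (loc r) = rg s r
    & forall j i, j < 8 -> m (X + 8 * i + j) = ar s j i].

Section Simulation.
Variables (P : seq instr) (X : nat).
Hypothesis HX : 20 <= X.

Lemma rep_scratch m s a v : 0 < a < 4 -> rep X m s -> rep X (upd m a v) s.
Proof.
move=> Ha [H0 Hr Ha']; split.
- by rewrite /upd ifF //; lia.
- by move=> r Hr'; rewrite /upd ifF ?Hr // /loc; lia.
- by move=> j i Hj; rewrite /upd ifF ?Ha' //; lia.
Qed.

Lemma rep_setr m s r v : r < nregs -> rep X m s ->
  rep X (upd m (loc r) v) (setr s r v).
Proof.
rewrite /nregs => Hr [H0 Hr' Ha]; split.
- by rewrite /upd ifF // /loc; lia.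
- move=> r' Hr1 /=; rewrite eqb_eqn /upd /loc eqn_add2r; case: eqP => // _.
  exact: Hr'.
- by move=> j i Hj; rewrite /upd ifF ?Ha // /loc; lia.
Qed.

Lemma rep_seta m s j i v : j < 8 -> rep X m s ->
  rep X (upd m (X + 8 * i + j) v) (seta s j i v).
Proof.
move=> Hj [H0 Hr Ha]; split.
- by rewrite /upd ifF //; lia.
- by move=> r Hr'; rewrite /upd ifF ?Hr // /loc; move: Hr'; rewrite /nregs; lia.
- move=> j' i' Hj' /=; rewrite eqb_eqn {1}/upd.
  case: (j' =P j) => [->|Hjj].
    rewrite /upd; case: (i' =P i) => [->|Hii]; first by rewrite eqxx.
    by rewrite ifF ?Ha //; lia.
  by rewrite ifF ?Ha //; lia.
Qed.

Lemma exec_address m s j a : j < 8 -> a < nregs -> rep X m s ->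
  let m' := foldl exec1 m (address j a) in
  [/\ m' 1 = X + 8 * rg s a + j, rep X m' s & m' 3 = m 3].
Proof.
move=> Hj Ha R; have [H0 Hr _] := R.
rewrite /address /=; split.
- rewrite /upd /= Hr // H0; lia.
- do 6![apply: rep_scratch => //].
- by rewrite /upd.
Qed.

(** Commands contain no backward jump, so the length of the code bounds the running time. Cell 3 has
    to survive because it holds the counter of an enclosing loop. *)
Lemma compile_ok c pc m s : wf c -> code_at P pc (compile c pc) -> rep X m s ->
  exists t m', [/\ t <= csize c, runs P t (pc, m) (pc + csize c, m'),
                   rep X m' (eval c s) & m' 3 = m 3].
Proof.
have loc3 r : (3 == loc r) = false by rewrite /loc addnC.
elim: c pc m s => [|r k|r a b|r a b|r j a|j a b|a c IHc d IHd|c IHc d IHd] pc m s /=.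
- by move=> _ _ R; exists 0, m; rewrite addn0; split.
- move=> Hr /runs_straight C R; exists 1, (upd m (loc r) k); split=> //.
  + exact: (C m).
  + exact: rep_setr.
  + by rewrite /upd loc3.
- move=> /and3P[Hr Ha Hb] /runs_straight C R; have [_ Er _] := R.
  exists 1, (upd m (loc r) (m (loc a) + m (loc b))); split=> //.
  + exact: (C m).
  + by rewrite !Er //; apply: rep_setr.
  + by rewrite /upd loc3.
- move=> /and3P[Hr Ha Hb] /runs_straight C R; have [_ Er _] := R.
  exists 1, (upd m (loc r) (m (loc a) - m (loc b))); split=> //.
  + exact: (C m).
  + by rewrite !Er //; apply: rep_setr.
  + by rewrite /upd loc3.
- move=> /and3P[Hr Hj Ha] /runs_straight C R.
  have [E1 R' E3] := exec_address Hj Ha R; have [_ _ Ea] := R'.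
  have C' : runs P 7 (pc, m)
    (pc + 7, exec1 (foldl exec1 m (address j a)) (ILoad (loc r) 1)) := C m isT.
  exists 7; eexists; split; [by []|exact: C'| |]; rewrite /exec1.
  + by rewrite E1 Ea //; apply: rep_setr.
  + by rewrite /upd loc3.
- move=> /and3P[Hj Ha Hb] /runs_straight C R.
  have [E1 R' E3] := exec_address Hj Ha R; have [_ Er _] := R'.
  have C' : runs P 7 (pc, m)
    (pc + 7, exec1 (foldl exec1 m (address j a)) (IStore 1 (loc b))) := C m isT.
  exists 7; eexists; split; [by []|exact: C'| |]; rewrite /exec1.
  + by rewrite E1 Er //; apply: rep_seta.
  + by rewrite {1}/upd E1 ifF ?E3 //; lia.
- move=> /and3P[Ha Hc Hd] /code_at_cons [Cj] /code_at_cat [Cd] /code_at_cons [Cm Cc] R.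
  rewrite !size_compile in Cj Cm Cc; have [_ Er _] := R.
  have Rj := runs_jz m Cj; rewrite Er // in Rj.
  case: eqP Rj => [_ Rj|_ Rj].
    have [t [m' [Ht Rc R' E3]]] := IHc _ _ _ Hc Cc R.
    exists (1 + t), m'; split=> //; first by lia.
    have -> : pc + (csize d + (csize c).+1).+1 = (pc.+1 + csize d).+1 + csize c by lia.
    exact: runs_trans Rj Rc.
  have [t [m' [Ht Rd R' E3]]] := IHd _ _ _ Hd Cd R.
  exists (1 + (t + 1)), m'; split=> //; first by lia.
  have -> : pc + (csize d + (csize c).+1).+1 = (pc.+1 + csize d).+1 + csize c by lia.
  by apply: runs_trans Rj (runs_trans Rd (runs_jmp m' Cm)).
- move=> /andP[Hc Hd] /code_at_cat [Cc Cd] R; rewrite !size_compile in Cd.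
  have [t1 [m1 [Ht1 Rc R1 E1]]] := IHc _ _ _ Hc Cc R.
  have [t2 [m2 [Ht2 Rd R2 E2]]] := IHd _ _ _ Hd Cd R1.
  exists (t1 + t2), m2; rewrite addnA; split=> //.
  + exact: leq_add.
  + exact: runs_trans Rc Rd.
  + by rewrite E2.
Qed.

(** Loop bodies are commands, so loops do not nest: one counter cell suffices, and an iteration has
    constant cost. The count is copied on entry, so a body may overwrite the register that held
    it. *)
Inductive hprog : Type :=
| PCmd (c : hcmd)
| PLoop (r : nat) (c : hcmd)
| PSeq (p q : hprog).

Fixpoint pwf (p : hprog) : bool :=
  match p with
  | PCmd c => wf c
  | PLoop r c => (r < nregs) && wf c
  | PSeq p q => pwf p && pwf q
  end.

Fixpoint peval (p : hprog) (s : state) : state :=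
  match p with
  | PCmd c => eval c s
  | PLoop r c => iter (rg s r) (eval c) s
  | PSeq p q => peval q (peval p s)
  end.

(** The 4 counts the test, the two instructions of [decrement] and the jump back; the 3 counts the
    two instructions that set the counter and the last, successful test. *)
Fixpoint cost (p : hprog) (s : state) : nat :=
  match p with
  | PCmd c => csize c
  | PLoop r c => 3 + rg s r * (csize c + 4)
  | PSeq p q => cost p s + cost q (peval p s)
  end.

Definition decrement := [:: IConst 1 1; ISub 3 3 1].

Fixpoint pcompile (p : hprog) (pc : nat) : seq instr :=
  match p with
  | PCmd c => compile c pc
  | PLoop r c =>
      [:: IConst 1 0; IAdd 3 (loc r) 1] ++
      IJz 3 (pc.+2.+1 + csize c).+2.+1 ::
      compile c pc.+2.+1 ++ decrement ++ [:: IJmp pc.+2]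
  | PSeq p q => let cp := pcompile p pc in cp ++ pcompile q (pc + size cp)
  end.

Lemma loop_ok r c pc m s k : wf c -> r < nregs ->
  nth IHalt P pc = IJz 3 (pc.+1 + csize c).+2.+1 ->
  code_at P pc.+1 (compile c pc.+1) ->
  code_at P (pc.+1 + csize c) decrement ->
  nth IHalt P (pc.+1 + csize c).+2 = IJmp pc ->
  rep X m s -> m 3 = k ->
  exists t m', [/\ t <= k * (csize c + 4) + 1,
     runs P t (pc, m) ((pc.+1 + csize c).+2.+1, m')
   & rep X m' (iter k (eval c) s)].
Proof.
move=> Hc Hr Cj Cc Cd Cm; elim: k m s => [|k IH] m s R E3.
  exists 1, m; split=> //; have := runs_jz m Cj; by rewrite E3.
have R0 := runs_jz m Cj; rewrite E3 /= in R0.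
have [t1 [m1 [Ht1 R1 rep1 E1]]] := compile_ok Hc Cc R.
have R2 := runs_straight m1 Cd isT.
set m2 := foldl _ _ _ in R2.
have rep2 : rep X m2 (eval c s) by do 2![apply: rep_scratch => //].
have E2 : m2 3 = k by rewrite /m2 /= /upd /= E1 E3 subn1.
have R3 := runs_jmp m2 Cm.
have [t4 [m4 [Ht4 R4 rep4]]] := IH _ _ rep2 E2.
exists (1 + (t1 + (2 + (1 + t4)))), m4; split.
- lia.
- apply: runs_trans R0 _; apply: runs_trans R1 _.
  apply: runs_trans R2 _; rewrite addn2; exact: runs_trans R3 R4.
- by rewrite iterSr.
Qed.

Lemma pcompile_ok p pc m s : pwf p -> code_at P pc (pcompile p pc) -> rep X m s ->
  exists t m', [/\ t <= cost p s,
     runs P t (pc, m) (pc + size (pcompile p pc), m') & rep X m' (peval p s)].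
Proof.
elim: p pc m s => [c|r c|p IHp q IHq] pc m s /=.
- move=> Hc C R; have [t [m' [? ? ? _]]] := compile_ok Hc C R.
  by exists t, m'; rewrite size_compile.
- move=> /andP[Hr Hc] C R.
  have {C} /code_at_cat [C0 /code_at_cons [Cj /code_at_cat [Cc /code_at_cat [Cd Ce]]]] :
    code_at P pc ([:: IConst 1 0; IAdd 3 (loc r) 1] ++
      IJz 3 (pc.+2.+1 + csize c).+2.+1 ::
      compile c pc.+2.+1 ++ decrement ++ [:: IJmp pc.+2]) by [].
  have [Cm _] := code_at_cons Ce.
  have R1 := runs_straight m C0 isT.
  set m1 := foldl _ _ _ in R1.
  rewrite /= addn2 size_compile in Cj Cc Cd Cm R1; rewrite ?addn2 in Cm.
  have rep1 : rep X m1 s by do 2![apply: rep_scratch => //].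
  have E3 : m1 3 = rg s r.
    by rewrite /m1 /= /upd /= addn0 ifF; [case: R => _ -> | rewrite /loc; lia].
  have [t [m' [Ht Rt rept]]] := loop_ok Hc Hr Cj Cc Cd Cm rep1 E3.
  exists (2 + t), m'; split=> //; first by lia.
  rewrite size_cat size_compile /=.
  have -> : pc + (csize c + 3).+3 = (pc.+3 + csize c).+3 by lia.
  exact: runs_trans R1 Rt.
- move=> /andP[Hp Hq] /code_at_cat [Cp Cq] R.
  have [t1 [m1 [Ht1 R1 rep1]]] := IHp _ _ _ Hp Cp R.
  have [t2 [m2 [Ht2 R2 rep2]]] := IHq _ _ _ Hq Cq rep1.
  exists (t1 + t2), m2; rewrite size_cat addnA; split=> //.
  + exact: leq_add.
  + exact: runs_trans R1 R2.
Qed.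

End Simulation.

(** * Relocation of the input *)

(* The input occupies the cells that the program needs as registers.  Cell 0
   holds the input length L; doubling it gives an address 32 L beyond the
   input to which the low cells can be saved before any of them is used.
   Entry i of the input goes to cell 32 L + 8 i; entries 0 .. 18 come from the
   twenty low cells, whence 144 = 8 * 18, 152 = 8 * 19 and 608 = 32 * 19.  The
   remaining entries are copied by a loop counting 32 L down by 32, and a second
   such loop recovers L. *)
Definition save_low (k : nat) : seq instr :=
  flatten [seq [:: IAdd 0 0 1; IStore 0 j] | j <- iota 2 k].

Definition prologue : seq instr :=
  [:: IAdd 0 0 0; IAdd 0 0 0; IAdd 0 0 0; IAdd 0 0 0; IAdd 0 0 0;
      IStore 0 1; IConst 1 8] ++ save_low 18 ++
  [:: IConst 2 144; ISub 0 0 2; IConst 4 20; IConst 2 152; IAdd 5 0 2;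
      IConst 2 608; ISub 6 0 2; IConst 7 1; IConst 8 32] ++
  [:: IJz 6 59; ILoad 2 4; IStore 5 2; IAdd 4 4 7; IAdd 5 5 1; ISub 6 6 8;
      IJmp 52] ++
  [:: IConst 4 0; IConst 2 0; IAdd 6 0 2] ++
  [:: IJz 6 66; IAdd 4 4 7; ISub 6 6 8; IJmp 62].

Section Prologue.
Variables (P : seq instr) (input : seq nat).
Hypothesis Hin : 0 < size input.
Hypothesis HP : code_at P 0 prologue.
Let X := 32 * size input.

(** Invariant of the relocation. The last clause keeps the entries not yet moved readable (entry [i]
    starts in cell [i + 1], as cell 0 holds the length); it leaves out the cells below 20, which
    thereby become work space. *)
Definition copied (c : nat) (m : nat -> nat) : Prop :=
  [/\ forall i, m (X + 8 * i) = if i < c then nth 0 input i else 0,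
      forall i j, 0 < j < 8 -> m (X + 8 * i + j) = 0
    & forall a, 20 <= a < X -> m a = nth 0 input a.-1].

Lemma copied_upd c m a v : a < 20 -> copied c m -> copied c (upd m a v).
Proof.
move=> Ha [H1 H2 H3]; split.
- by move=> i; rewrite /upd ifF ?H1 //; rewrite /X; lia.
- by move=> i j Hj; rewrite /upd ifF ?H2 //; rewrite /X; lia.
- by move=> b Hb; rewrite /upd ifF ?H3 //; lia.
Qed.

Lemma copied_store c m : copied c m ->
  copied c.+1 (upd m (X + 8 * c) (nth 0 input c)).
Proof.
move=> [H1 H2 H3]; split.
- move=> i; rewrite /upd; case: (ltngtP i c) => Hic.
  + by rewrite ifF ?H1 ?ifT //; lia.
  + by rewrite ifF ?H1 ?ifF //; lia.
  + by rewrite Hic eqxx ifT //; lia.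
- by move=> i j Hj; rewrite /upd ifF ?H2 //; lia.
- by move=> b Hb; rewrite /upd ifF ?H3 //; lia.
Qed.

Lemma save_low_ok k m : k <= 18 ->
  m 0 = X -> m 1 = 8 -> copied 1 m ->
  (forall a, 2 <= a < 20 -> m a = nth 0 input a.-1) ->
  let m' := foldl exec1 m (save_low k) in
  [/\ m' 0 = X + 8 * k, m' 1 = 8, copied k.+1 m'
    & forall a, k.+1 < a < 20 -> m' a = nth 0 input a.-1].
Proof.
move=> Hk H0 H1 Hc Hl; elim: k Hk => [|k IH] Hk.
  by rewrite /= addn0; split.
have [I0 I1 Ic Il] := IH (ltnW Hk).
have -> : save_low k.+1 = save_low k ++ [:: IAdd 0 0 1; IStore 0 (2 + k)].
  by rewrite /save_low -(addn1 k) iotaD map_cat flatten_cat.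
rewrite foldl_cat.
set m1 := foldl _ _ (save_low k) in I0 I1 Ic Il *.
rewrite /=; set m2 := upd m1 0 _.
have E0 : m2 0 = X + 8 * k.+1 by rewrite /m2 /upd /= I0 I1; lia.
have Ek : m2 (2 + k) = nth 0 input k.+1.
  by rewrite /m2 /upd /= Il //; lia.
have HX : 32 <= X by rewrite /X; lia.
rewrite E0 Ek; split.
- by rewrite {1}/upd ifF ?E0 //; lia.
- by rewrite {1}/upd ifF /m2 /upd //=; lia.
- by apply: copied_store; apply: copied_upd.
- move=> a Ha; rewrite {1}/upd ifF; last by lia.
  by rewrite /m2 /upd ifF ?Il //; lia.
Qed.

(** Sources lie below [X] and targets at [X] or above, so no unread entry is destroyed. For an input
    of at most 19 entries the truncated difference makes [k = 0]. *)
Lemma copy_loop_ok k c m : k = size input - c -> 19 <= c ->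
  m 0 = X -> m 1 = 8 -> m 4 = c.+1 -> m 5 = X + 8 * c -> m 6 = 32 * k ->
  m 7 = 1 -> m 8 = 32 -> copied c m ->
  exists t m', [/\ t <= k * 7 + 1, runs P t (52, m) (59, m'), m' 0 = X,
    m' 7 = 1 /\ m' 8 = 32 & copied (k + c) m'].
Proof.
have /code_at_cons [Cj /code_at_cat [Cb /code_at_cons [Cm _]]] :
    code_at P 52 ([:: IJz 6 59] ++ [:: ILoad 2 4; IStore 5 2; IAdd 4 4 7;
     IAdd 5 5 1; ISub 6 6 8] ++ [:: IJmp 52]).
  by move=> i Hi; rewrite HP //=; move: Hi; do 7![case: i => [|i] //].
have HX : 32 <= X by rewrite /X; lia.
elim: k c m => [|k IH] c m Hk Hc H0 H1 H4 H5 H6 H7 H8 Hcp.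
  exists 1, m; split=> //; have := runs_jz m Cj; by rewrite H6.
have R0 := runs_jz m Cj; rewrite H6 /= in R0.
have R1 := runs_straight m Cb isT.
set m1 := foldl _ _ _ in R1.
have R2 := runs_jmp m1 Cm.
have E : m1 = upd (upd (upd (upd (upd m 2 (nth 0 input c)) (X + 8 * c)
                       (nth 0 input c)) 4 c.+2) 5 (X + 8 * c.+1)) 6 (32 * k).
  have E4 : m (m 4) = nth 0 input c.
    by case: Hcp => _ _ H3; rewrite H4 H3 // /X; lia.
  rewrite /m1 /= E4.
  have -> : upd m 2 (nth 0 input c) 5 = X + 8 * c by rewrite /upd /= H5.
  have -> : upd m 2 (nth 0 input c) 2 = nth 0 input c by [].
  set m2 := upd (upd m 2 _) _ _.
  have Eq a : a < 20 -> a != 2 -> m2 a = m a.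
    by move=> Ha Ha2; rewrite /m2 /upd ifF ?ifF //; lia.
  have -> : m2 4 + m2 7 = c.+2 by rewrite !Eq // H4 H7 addn1.
  have -> : upd m2 4 c.+2 5 + upd m2 4 c.+2 1 = X + 8 * c.+1.
    by rewrite /upd /= !Eq // H5 H1 mulnS; lia.
  set m4 := upd (upd m2 4 _) 5 _.
  have -> : m4 6 - m4 8 = 32 * k by rewrite /m4 /upd /= !Eq // H6 H8; lia.
  by [].
have Eq a : a < 20 -> a \notin [:: 2; 4; 5; 6] -> m1 a = m a.
  rewrite !inE !negb_or => Ha /and4P[n2 n4 n5 n6].
  by rewrite E /upd !ifF //; lia.
have [||||||||||t [m' [Ht Rt Z0 Z78 Zc]]] := IH c.+1 m1.
- lia.
- lia.
- by rewrite Eq.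
- by rewrite Eq.
- by rewrite E.
- by rewrite E.
- by rewrite E.
- by rewrite Eq.
- by rewrite Eq.
- rewrite E; do 3![apply: copied_upd => //]; apply: copied_store; exact: copied_upd.
exists (1 + (5 + (1 + t))), m'; split=> //.
- apply: runs_trans R0 _; apply: runs_trans R1 _; exact: runs_trans R2 Rt.
- by rewrite addSnnS.
Qed.

Lemma count_loop_ok k m : m 6 = 32 * k -> m 7 = 1 -> m 8 = 32 ->
  exists t m', [/\ t <= k * 4 + 1, runs P t (62, m) (66, m'), m' 4 = m 4 + k
    & forall a, a != 4 -> a != 6 -> m' a = m a].
Proof.
have /code_at_cons [Cj /code_at_cat [Cb /code_at_cons [Cm _]]] :
    code_at P 62 ([:: IJz 6 66] ++ [:: IAdd 4 4 7; ISub 6 6 8] ++ [:: IJmp 62]).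
  by move=> i Hi; rewrite HP //=; move: Hi; do 4![case: i => [|i] //].
elim: k m => [|k IH] m H6 H7 H8.
  exists 1, m; rewrite addn0; split=> //; have := runs_jz m Cj; by rewrite H6.
have R0 := runs_jz m Cj; rewrite H6 /= in R0.
have R1 := runs_straight m Cb isT.
set m1 := foldl _ _ _ in R1.
have R2 := runs_jmp m1 Cm.
have [|||t [m' [Ht Rt Z4 Z]]] := IH m1.
- by rewrite /m1 /= /upd /= H6 H8; lia.
- by rewrite /m1 /= /upd /= H7.
- by rewrite /m1 /= /upd /= H8.
exists (1 + (2 + (1 + t))), m'; split=> //.
- apply: runs_trans R0 _; apply: runs_trans R1 _; exact: runs_trans R2 Rt.
- by rewrite Z4 /m1 /= /upd /= H7 addn1 addSnnS.
- by move=> a Ha Hb; rewrite Z // /m1 /= /upd (negbTE Ha) (negbTE Hb).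
Qed.

(** [X] exceeds the input length and all cells beyond the input start at 0, so the arrays lie in
    clean memory. *)
Lemma doubled_ok m :
  (forall a, m a = if a == 1 then 8 else if a == X then nth 0 input 0 else
    if a == 0 then X else nth 0 input a.-1) ->
  [/\ m 0 = X, m 1 = 8, copied 1 m
    & forall a, 2 <= a < 20 -> m a = nth 0 input a.-1].
Proof.
move=> E; have HX : 32 <= X by rewrite /X; lia.
have HXs : size input < X by rewrite /X; lia.
have E' a : 1 < a -> m a = if a == X then nth 0 input 0 else nth 0 input a.-1.
  by case: a E => [|[|a]] // E _; rewrite E.
have Z a : X < a -> m a = 0.
  by move=> Ha; rewrite E' ?gtn_eqF ?nth_default //; lia.
split.
- by rewrite E /= ifF //; lia.
- by rewrite E.
- split.
  + case=> [|i]; first by rewrite muln0 addn0 E' ?eqxx //; lia.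
    by rewrite Z //; lia.
  + by move=> i j Hj; rewrite Z //; lia.
  + by move=> a Ha; rewrite E' ?ltn_eqF //; lia.
- by move=> a Ha; rewrite E' ?ltn_eqF //; lia.
Qed.

Lemma saved_ok : exists m,
  [/\ runs P 43 (init input) (43, m), m 0 = X + 8 * 18, m 1 = 8 & copied 19 m].
Proof.
have [C1 /code_at_cat [C2 _]] := code_at_cat HP.
have R1 := runs_straight (init input).2 C1 isT.
set m1 := foldl _ _ _ in R1.
have E1 a : m1 a = if a == 1 then 8 else if a == X then nth 0 input 0 else
    if a == 0 then X else nth 0 input a.-1.
  rewrite /m1 /= /upd /=; set y := (_ + _).
  have -> : y = X by rewrite /y /X; lia.
  by case: (a == 1) => //; case: (a == X) => //; case: (a == 0).
clearbody m1; have [I0 I1 Ic Il] := doubled_ok E1.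
have [J0 J1 Jc _] := @save_low_ok 18 m1 isT I0 I1 Ic Il.
have R2 := runs_straight m1 C2 isT.
set m2 := foldl _ _ _ in J0 J1 Jc R2; clearbody m2.
by exists m2; split=> //; apply: (runs_trans R1 R2).
Qed.

Lemma loop_setup_ok m : m 0 = X + 8 * 18 -> m 1 = 8 -> copied 19 m ->
  exists m', [/\ runs P 9 (43, m) (52, m'), m' 0 = X /\ m' 1 = 8,
    [/\ m' 4 = 20, m' 5 = X + 8 * 19 & m' 6 = 32 * (size input - 19)],
    m' 7 = 1 /\ m' 8 = 32 & copied 19 m'].
Proof.
move=> H0 H1 Hc.
have [_ /code_at_cat [_ /code_at_cat [C3 _]]] := code_at_cat HP.
have R3 := runs_straight m C3 isT.
exists (foldl exec1 m
  [:: IConst 2 144; ISub 0 0 2; IConst 4 20; IConst 2 152; IAdd 5 0 2;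
      IConst 2 608; ISub 6 0 2; IConst 7 1; IConst 8 32]); split.
- exact: R3.
- by rewrite /= /upd /= H0 H1; split=> //; lia.
- by rewrite /= /upd /= H0; split=> //; rewrite /X; lia.
- by rewrite /= /upd.
- by rewrite /=; do 9![apply: copied_upd; first by []].
Qed.

Lemma prologue_ok : exists t m s, [/\ t <= 100 + 11 * size input,
    runs P t (init input) (66, m), rep X m s, rg s 0 = size input
  & forall j i, j < 8 -> ar s j i = if j == 0 then nth 0 input i else 0].
Proof.
have [m2 [R2 A0 A1 Ac]] := saved_ok.
have [m3 [R3 [J0 J1] [J4 J5 J6] [J7 J8] Jc]] := loop_setup_ok A0 A1 Ac.
have [t4 [m4 [Ht4 R4 K0 [K7 K8] Kc]]] :=
  copy_loop_ok erefl (leqnn 19) J0 J1 J4 J5 J6 J7 J8 Jc.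
have C4 : code_at P 59 [:: IConst 4 0; IConst 2 0; IAdd 6 0 2].
  by have [_ /code_at_cat [_ /code_at_cat [_ /code_at_cat [_ /code_at_cat [C _]]]]] :=
    code_at_cat HP.
have R5 := runs_straight m4 C4 isT.
set m5 := foldl _ _ _ in R5.
have [|||t6 [m6 [Ht6 R6 L4 L]]] := @count_loop_ok (size input) m5.
- by rewrite /m5 /= /upd /= K0 addn0.
- by rewrite /m5 /= /upd /= K7.
- by rewrite /m5 /= /upd /= K8.
have Lc : copied (size input - 19 + 19) m6.
  have [Q1 Q2 Q3] : copied (size input - 19 + 19) m5.
    by do 3![apply: copied_upd; first by []].
  have HX : 32 <= X by rewrite /X; lia.
  by split=> *; rewrite L ?Q1 ?Q2 ?Q3 //; lia.
case: Lc => Lc1 Lc2 _.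
exists (43 + (9 + (t4 + (3 + t6)))), m6,
  (State (fun r => m6 (loc r)) (fun j i => m6 (X + 8 * i + j))); split.
- lia.
- apply: runs_trans R2 _; apply: runs_trans R3 _.
  apply: runs_trans R4 _; exact: runs_trans R5 R6.
- by split=> //; rewrite L // /m5 /= /upd /= K0.
- by rewrite /= L4.
- move=> j i Hj /=; case: eqP => [->|/eqP Hj0]; last by rewrite Lc2 // lt0n Hj0.
  rewrite addn0 Lc1; case: ifP => // /negbT Hi; rewrite nth_default //; lia.
Qed.

End Prologue.

(** * Induced matchings in unions, joins, trees and their complements *)

Lemma sgC n e u v : sg n e u v = sg n e v u.
Proof.
rewrite /sg (eq_sym u v); case: (u < n); case: (v < n); rewrite //= andbC.
by case: (v != u); rewrite ?andbT ?andbF //= andbC.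
Qed.

Lemma sg_irr n e u : sg n e u u = false.
Proof. by rewrite /sg eqxx !andbF. Qed.

Lemma sg_lt n e u v : sg n e u v -> u < n /\ v < n.
Proof. by case/and4P. Qed.

Definition treelike (A : {pred nat}) (adj : rel nat) : Prop :=
  exists r : nat -> nat, forall u v w, u \in A -> v \in A -> w \in A ->
    adj u v -> adj u w -> r v <= r u -> r w <= r u -> v = w.

(** * The rank function of a tree: distance from vertex 0 *)

Section Bfs.
Variables (n : nat) (e : rel nat).
Hypothesis Ht : is_tree n e.

Let n_gt0 : 0 < n. Proof. by case: Ht => -[]. Qed.

(** Walks from vertex 0 of length exactly [k], as a boolean so that [ex_minn] can select the
    distance. *)
Fixpoint reach (k : nat) (v : nat) : bool :=
  if k is k'.+1 then has (fun u => reach k' u && sg n e u v) (iota 0 n)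
  else v == 0.

Lemma reach_ex (v : 'I_n) : exists k, reach k v.
Proof.
case: Ht => -[_ Hc] _; have [p [Hp Hl]] := Hc _ _ n_gt0 (ltn_ord v).
rewrite -Hl; clear Hl; elim/last_ind: p Hp => [|p x IH]; first by exists 0; rewrite /= eqxx.
rewrite rcons_path last_rcons => /andP[/IH [k Hk] Hx]; exists k.+1.
apply/hasP; exists (last 0 p); first by rewrite mem_iota /=; case: (sg_lt Hx).
by apply/andP; split.
Qed.

Definition dist (v : 'I_n) : nat := ex_minn (reach_ex v).

Lemma dist_parent (v : 'I_n) : v != 0 :> nat ->
  exists u : 'I_n, sg n e u v && (dist u < dist v).
Proof.
rewrite /dist; case: (ex_minnP (reach_ex v)) => -[|k] /=; first by move=> /eqP->.
move=> /hasP [u]; rewrite mem_iota add0n /= => Hu /andP[Hk Hs] _ _.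
exists (Ordinal Hu); rewrite Hs /=; case: ex_minnP => j _ Hj.
by rewrite ltnS; apply: Hj.
Qed.

Definition par (v : 'I_n) : 'I_n :=
  odflt v [pick u : 'I_n | sg n e u v && (dist u < dist v)].

Lemma parP (v : 'I_n) : v != 0 :> nat -> sg n e (par v) v /\ dist (par v) < dist v.
Proof.
move=> /dist_parent [u Hu]; rewrite /par; case: pickP => [w /andP //|/(_ u)].
by rewrite Hu.
Qed.

Definition edge_set : {set 'I_n * 'I_n} := [set p : 'I_n * 'I_n | (p.1 < p.2) && sg n e p.1 p.2].

Lemma card_edge_set : #|edge_set| = n.-1.
Proof.
case: Ht => _ <-; rewrite /nedges pair_big /= -sum1_card big_mkcond /=.
by apply: eq_bigr => p _; rewrite inE; case: (_ && _).
Qed.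

Definition tree_edge (v : 'I_n) : 'I_n * 'I_n :=
  if v < par v then (v, par v) else (par v, v).

(** If two distinct vertices gave the same edge, each would be the parent of the other and hence
    strictly nearer to vertex 0 than the other. *)
Lemma tree_edge_inj : {in [pred v : 'I_n | v != 0 :> nat] &, injective tree_edge}.
Proof.
move=> u v; rewrite !inE => /parP [_ Hu] /parP [_ Hv]; rewrite /tree_edge.
case: ifP; case: ifP => _ _ [E1 E2] //.
- by move: Hu Hv; rewrite E2 -E1 => H1 H2; have := ltn_trans H1 H2; rewrite ltnn.
- by move: Hu Hv; rewrite E1 -E2 => H1 H2; have := ltn_trans H1 H2; rewrite ltnn.
Qed.

(* The n - 1 edges from the vertices other than 0 to their BFS parents are
   distinct, hence they are all the edges. *)
Lemma edge_par (u v : 'I_n) : sg n e u v ->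
  (u = par v /\ dist u < dist v) \/ (v = par u /\ dist v < dist u).
Proof.
suff H (a b : 'I_n) : a < b -> sg n e a b ->
    (a = par b /\ dist a < dist b) \/ (b = par a /\ dist b < dist a).
  move=> Huv; case: (ltngtP u v) => [|/H|] .
  - by move/H; apply.
  - by rewrite sgC => /(_ Huv) [|]; [right|left].
  - by move=> Euv; move: Huv; rewrite Euv sg_irr.
move=> Hab Hs.
have He : [set tree_edge w | w in [pred v : 'I_n | v != 0 :> nat]] = edge_set.
  apply/eqP; rewrite eqEcard; apply/andP; split.
    apply/subsetP => q /imsetP [w]; rewrite inE => /parP [Hw _] ->.
    have Hne : par w != w :> nat by apply: contraL Hw => /eqP->; rewrite sg_irr.
    rewrite inE /tree_edge; case: ifP => /= Hlt; first by rewrite Hlt sgC.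
    by rewrite ltn_neqAle Hne leqNgt Hlt.
  rewrite card_in_imset; last exact: tree_edge_inj.
  rewrite card_edge_set (@eq_card _ _ (predC1 (Ordinal n_gt0))).
    by rewrite cardC1 card_ord.
  by move=> w; rewrite !inE.
have : (a, b) \in edge_set by rewrite inE Hab.
rewrite -He => /imsetP [w]; rewrite inE => /parP [_ Hw].
by rewrite /tree_edge; case: ifP => _ [-> ->]; [right|left].
Qed.

(** By [edge_par] a neighbour is either the parent or a child, and a child has larger distance; so
    the only neighbour of rank at most that of [u] is [par u]. *)
Lemma tree_treelike : treelike (gtn n) (sg n e).
Proof.
exists (fun v => oapp dist 0 (insub v)) => u v w Hu Hv Hw.
rewrite !insubT /=; set u' := Sub u Hu; set v' := Sub v Hv; set w' := Sub w Hw.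
move=> Huv Huw Hd1 Hd2.
have [[_]|[E1 _]] := @edge_par u' v' Huv; first by rewrite ltnNge Hd1.
have [[_]|[E2 _]] := @edge_par u' w' Huw; first by rewrite ltnNge Hd2.
have : v' = w' by rewrite E1 E2.
by case.
Qed.

End Bfs.

(** Settles complements of two-vertex trees, which have no edge and hence matching number 0. *)
Lemma tree_size2 e : is_tree 2 e -> sg 2 e 0 1.
Proof.
move=> [[_ Hc] _]; have [[|x p] [Hp Hl]] := Hc 0 1 isT isT; first by [].
move: Hp => /= /andP[Hx _]; have [_ Hx2] := sg_lt Hx.
by case: x Hx Hx2 {Hl} => [|[|]] //; rewrite sg_irr.
Qed.

Lemma treelike_nth (adj : rel nat) (Sv : seq nat) :
  uniq Sv ->
  treelike (gtn (size Sv)) (fun i j => adj (nth 0 Sv i) (nth 0 Sv j)) ->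
  treelike [in Sv] adj.
Proof.
move=> U [r Hr]; exists (fun v => r (index v Sv)) => u v w Hu Hv Hw Huv Huw H1 H2.
rewrite -(nth_index 0 Hv) -(nth_index 0 Hw); congr nth.
by apply: (Hr (index u Sv)); rewrite ?inE ?index_mem ?nth_index.
Qed.

Lemma treelike_eq (A : {pred nat}) (f g : rel nat) :
  {in A &, f =2 g} -> treelike A f -> treelike A g.
Proof.
move=> E [r Hr]; exists r => u v w Hu Hv Hw; rewrite -!E //; exact: Hr.
Qed.

Section Matchings.
Variables (n : nat) (e : rel nat).
Let adj := sg n e.

Let adjC u v : adj u v = adj v u := sgC n e u v.
Let adj_irr u : adj u u = false := sg_irr n e u.

Definition apart (p q : nat * nat) : bool :=
  all (fun x => all (fun y => (x != y) && ~~ adj x y) [:: q.1; q.2]) [:: p.1; p.2].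

Definition im_in (A : seq nat) (M : seq (nat * nat)) : bool :=
  induced_matching n e M && all (fun p => (p.1 \in A) && (p.2 \in A)) M.

Definition mim (A : seq nat) (k : nat) : Prop :=
  (exists M, im_in A M /\ size M = k) /\ (forall M, im_in A M -> size M <= k).

Lemma apartP p q : reflect
  (forall x y, x \in [:: p.1; p.2] -> y \in [:: q.1; q.2] -> x != y /\ ~~ adj x y)
  (apart p q).
Proof.
apply: (iffP allP) => [H x y Hx Hy|H x Hx].
  by have /allP /(_ y Hy) /andP := H x Hx.
by apply/allP => y Hy; apply/andP; apply: H.
Qed.

Lemma im_inP A M : reflect
  [/\ {in M, forall p, adj p.1 p.2}, pairwise apart M
    & {in M, forall p, p.1 \in A /\ p.2 \in A}] (im_in A M).
Proof.
apply: (iffP idP) => [/andP[/andP[/allP Ha Hp] /allP Hi]|[Ha Hp Hi]].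
  by split=> // p /Hi /andP.
apply/andP; split; last by apply/allP => p /Hi /andP.
by apply/andP; split=> //; apply/allP.
Qed.

Lemma im_in_edge A u v : u \in A -> v \in A -> adj u v -> im_in A [:: (u, v)].
Proof. by move=> Hu Hv Huv; rewrite /im_in /induced_matching /= Hu Hv !andbT; apply: Huv. Qed.

Lemma im_in_sub A B M : {subset A <= B} -> im_in A M -> im_in B M.
Proof.
by move=> H /im_inP [? ? Hi]; apply/im_inP; split=> // p /Hi [/H ? /H].
Qed.

Lemma im_in_filter A B (a : pred (nat * nat)) M : im_in A M ->
  (forall p, p \in M -> a p -> p.1 \in B /\ p.2 \in B) -> im_in B (filter a M).
Proof.
move=> /im_inP [Ha Hp Hi] H; apply/im_inP; split.
- by move=> p; rewrite mem_filter => /andP[_ /Ha].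
- exact: pairwise_filter.
- by move=> p; rewrite mem_filter => /andP[Hap /H]; apply.
Qed.

Lemma mim_union A B a b :
  (forall u v, u \in A -> v \in B -> ~~ adj u v) -> uniq (A ++ B) ->
  mim A a -> mim B b -> mim (A ++ B) (a + b).
Proof.
move=> HAB; rewrite cat_uniq => /and3P[_ /hasPn HD _].
move=> [[MA [HMA <-]] HA] [[MB [HMB <-]] HB]; split.
  exists (MA ++ MB); rewrite size_cat; split=> //.
  have /im_inP [Aa Ap Ai] := HMA; have /im_inP [Ba Bp Bi] := HMB.
  apply/im_inP; split.
  - by move=> p; rewrite mem_cat => /orP[/Aa|/Ba].
  - rewrite pairwise_cat Ap Bp !andbT; apply/allrelP => p q /Ai [p1 p2] /Bi [q1 q2].
    apply/apartP => x y Hx Hy.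
    have xA : x \in A by move: Hx; rewrite !inE => /orP[]/eqP->.
    have yB : y \in B by move: Hy; rewrite !inE => /orP[]/eqP->.
    split; last exact: HAB.
    by apply: contraNneq (HD _ yB) => <-.
  - move=> p; rewrite !mem_cat => /orP[/Ai|/Bi] [-> ->] //.
    by rewrite !orbT.
move=> M HM; rewrite -(count_predC (fun p => p.1 \in A)) -!size_filter.
have /im_inP [Ma _ Mi] := HM.
apply: leq_add; [apply: HA|apply: HB]; apply: im_in_filter HM _ => p pM /=.
  move=> Hp; split=> //; have [_] := Mi _ pM; rewrite mem_cat => /orP[//|Hp2].
  by have := HAB _ _ Hp Hp2; rewrite Ma.
move=> Hp; have [] := Mi _ pM; rewrite !mem_cat (negbTE Hp) /= => Hp1.
move=> /orP[Hp2|//]; have := HAB _ _ Hp2 Hp1; by rewrite adjC Ma.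
Qed.

Lemma mim_join A B a b :
  (forall u v, u \in A -> v \in B -> adj u v) -> 0 < size A -> 0 < size B ->
  mim A a -> mim B b -> mim (A ++ B) (maxn 1 (maxn a b)).
Proof.
move=> HAB sA sB [[MA [HMA EA]] HA] [[MB [HMB EB]] HB]; split.
  rewrite /maxn; case: ifP => _; last first.
    exists [:: (nth 0 A 0, nth 0 B 0)]; split=> //.
    by apply: im_in_edge; rewrite ?mem_cat ?mem_nth ?orbT //; apply: HAB; apply: mem_nth.
  case: ifP => _; [exists MB|exists MA]; split=> //.
    by apply: im_in_sub HMB => x Hx; rewrite mem_cat Hx orbT.
  by apply: im_in_sub HMA => x Hx; rewrite mem_cat Hx.
move=> M HM; case: M HM => [//|p [|q M]] HM; first by rewrite leq_max.
have /im_inP [Ma Mp Mi] := HM; rewrite !leq_max.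
have Hap r : r \in q :: M -> apart p r.
  by move: Mp; rewrite pairwise_cons => /andP[/allP H _]; apply: H.
have Hin x r : r \in p :: q :: M -> x \in [:: r.1; r.2] -> (x \in A) || (x \in B).
  by move=> /Mi [r1 r2]; rewrite -mem_cat !inE => /orP[]/eqP->.
have sideA x r y : x \in [:: p.1; p.2] -> r \in q :: M -> y \in [:: r.1; r.2] ->
    (x \in A -> y \in A) /\ (y \in A -> x \in A).
  move=> Hx Hr Hy; have [_ Hxy] := (apartP _ _ (Hap r Hr)) x y Hx Hy.
  have := Hin x p (mem_head _ _) Hx.
  have := Hin y r _ Hy; rewrite inE Hr orbT => /(_ isT) H H0.
  split=> [xA|yA].
  - by case/orP: H => // yB; rewrite HAB in Hxy.
  - by case/orP: H0 => // xB; rewrite adjC HAB in Hxy.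
have sideB x r y : x \in [:: p.1; p.2] -> r \in q :: M -> y \in [:: r.1; r.2] ->
    (x \in B -> y \in B) /\ (y \in B -> x \in B).
  move=> Hx Hr Hy; have [_ Hxy] := (apartP _ _ (Hap r Hr)) x y Hx Hy.
  have := Hin x p (mem_head _ _) Hx.
  have := Hin y r _ Hy; rewrite inE Hr orbT => /(_ isT) H H0.
  split=> [xA|yA].
  - by case/orP: H => // yB; rewrite adjC HAB in Hxy.
  - by case/orP: H0 => // xB; rewrite HAB in Hxy.
have H1 (r : nat * nat) : r.1 \in [:: r.1; r.2] by rewrite !inE eqxx.
have H2 (r : nat * nat) : r.2 \in [:: r.1; r.2] by rewrite !inE eqxx orbT.
have qM : q \in q :: M := mem_head _ _.
case/orP: (Hin p.1 p (mem_head _ _) (H1 p)) => Hp1; apply/orP; right; apply/orP.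
(* The edge [p] might itself run across the join, so membership in [A] is carried from [p.1] to
   [p.2] through an end of [q]. *)
- left; apply: HA; apply/im_inP; split=> // r; rewrite inE => /orP[/eqP->|Hr].
    split=> //; apply/(sideA p.2 q q.1) => //; exact/(sideA p.1 q q.1).
  by split; [apply/(sideA p.1 r r.1)|apply/(sideA p.1 r r.2)].
- right; apply: HB; apply/im_inP; split=> // r; rewrite inE => /orP[/eqP->|Hr].
    split=> //; apply/(sideB p.2 q q.1) => //; exact/(sideB p.1 q q.1).
  by split; [apply/(sideB p.1 r r.1)|apply/(sideB p.1 r r.2)].
Qed.

Definition coadj : rel nat := fun u v => (u != v) && ~~ adj u v.

Lemma coadjC u v : coadj u v = coadj v u.
Proof. by rewrite /coadj eq_sym adjC. Qed.

(* Two edges of an induced matching span a 4-cycle in the complement. *)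
Lemma mim_cotree A : uniq A -> treelike [in A] coadj ->
  (size A = 2 -> {in A &, forall u v, ~~ adj u v}) -> mim A (2 < size A).
Proof.
move=> U [r Hr] H2; split.
  case: (ltnP 2 (size A)) => HA; last by exists [::].
  suff [u [v [uA vA Huv]]] : exists u v, [/\ u \in A, v \in A & adj u v].
    by exists [:: (u, v)]; split=> //; apply: im_in_edge.
  case: A U HA Hr {H2} => [|x [|y [|z A]]] //= + _ Hr.
  rewrite !inE !negb_or => /and4P[/and3P[xy xz _] /andP[yz _] _ _].
  set S := [:: x, y, z & A] in Hr *.
  have xS : x \in S by rewrite !inE eqxx.
  have yS : y \in S by rewrite !inE eqxx orbT.
  have zS : z \in S by rewrite !inE eqxx !orbT.
  case axy : (adj x y); first by exists x, y.
  case axz : (adj x z); first by exists x, z.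
  case ayz : (adj y z); first by exists y, z.
  have cxy : coadj x y by rewrite /coadj xy axy.
  have cxz : coadj x z by rewrite /coadj xz axz.
  have cyz : coadj y z by rewrite /coadj yz ayz.
  (* Three pairwise nonadjacent vertices form a triangle in the tree, and its vertex of largest rank
     has two neighbours of no larger rank. *)
  have Nx := Hr x y z xS yS zS cxy cxz.
  have := Hr y x z yS xS zS; rewrite coadjC => /(_ cxy cyz) Ny.
  have := Hr z x y zS xS yS; rewrite !(coadjC z) => /(_ cxz cyz) Nz.
  move: xy xz yz; case: (leqP (r y) (r x)) => L1.
    case: (leqP (r z) (r x)) => L2; first by rewrite (Nx L1 L2) eqxx.
    by rewrite (Nz (ltnW L2) (leq_trans L1 (ltnW L2))) eqxx.
  case: (leqP (r z) (r y)) => L2; first by rewrite (Ny (ltnW L1) L2) eqxx.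
  by rewrite (Nz (ltnW (ltn_trans L1 L2)) (ltnW L2)) eqxx.
move=> [|p [|q M]] // /im_inP [Ma Mp Mi].
  have [p1 p2] := Mi p (mem_head _ _); have Hp := Ma p (mem_head _ _).
  case: ltnP => // HA; case: A U Hr H2 p1 p2 HA {Mi} => [|x [|y [|z A]]] //= _ _ H2 p1 p2 _.
    by move: Hp p1 p2; rewrite !inE => /[swap] /eqP-> /[swap] /eqP->; rewrite adj_irr.
  by have := H2 erefl _ _ p1 p2; rewrite Hp.
move: Mp => /= /andP[/andP[/apartP Hpq _] _].
have [p1 p2] := Mi p (mem_head _ _); have Hp := Ma p (mem_head _ _).
have qM : q \in [:: p, q & M] by rewrite !inE eqxx orbT.
have [q1 q2] := Mi q qM; have Hq := Ma q qM.
have np : p.1 <> p.2 by move=> E; rewrite E adj_irr in Hp.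
have nq : q.1 <> q.2 by move=> E; rewrite E adj_irr in Hq.
have C x y : x \in [:: p.1; p.2] -> y \in [:: q.1; q.2] -> coadj x y.
  by move=> Hx Hy; apply/andP; apply: Hpq.
have H1 (s : nat * nat) : s.1 \in [:: s.1; s.2] by rewrite !inE eqxx.
have H3 (s : nat * nat) : s.2 \in [:: s.1; s.2] by rewrite !inE eqxx orbT.
(* The 4-cycle is [p.1], [q.1], [p.2], [q.2]. Each [N] forbids one of its vertices to have largest
   rank; the case analysis below locates the largest. *)
have N1 := Hr p.1 q.1 q.2 p1 q1 q2 (C _ _ (H1 _) (H1 _)) (C _ _ (H1 _) (H3 _)).
have N2 := Hr p.2 q.1 q.2 p2 q1 q2 (C _ _ (H3 _) (H1 _)) (C _ _ (H3 _) (H3 _)).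
have := Hr q.1 p.1 p.2 q1 p1 p2; rewrite !(coadjC q.1).
move=> /(_ (C _ _ (H1 _) (H1 _)) (C _ _ (H3 _) (H1 _))) N3.
have := Hr q.2 p.1 p.2 q2 p1 p2; rewrite !(coadjC q.2).
move=> /(_ (C _ _ (H1 _) (H3 _)) (C _ _ (H3 _) (H3 _))) N4.
case: (leqP (r q.1) (r p.1)) => L1.
  case: (leqP (r q.2) (r p.1)) => L2; first by case: (nq (N1 L1 L2)).
  by case: (leqP (r p.2) (r q.2)) => L3; [case: (np (N4 (ltnW L2) L3))
    |case: (nq (N2 (leq_trans L1 (ltnW (ltn_trans L2 L3))) (ltnW L3)))].
case: (leqP (r p.2) (r q.1)) => L2; first by case: (np (N3 (ltnW L1) L2)).
case: (leqP (r q.2) (r p.2)) => L3; first by case: (nq (N2 (ltnW L2) L3)).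
by case: (np (N4 (ltnW (ltn_trans L1 (ltn_trans L2 L3))) (ltnW L3))).
Qed.

(* [x] marks the vertices matched to a child when the forest is treated
   greedily from the leaves: no child of a marked vertex is marked, and some
   child of it has no marked child.  The marked vertices with these children
   form an induced matching, and every edge meets v or par v for a marked
   vertex v, where two edges meeting {v, par v} are not apart. *)
Lemma mim_tree (A : seq nat) (par : nat -> option nat) (x a b : pred nat) :
  uniq A ->
  {in A &, forall u v, adj u v = (par u == Some v) || (par v == Some u)} ->
  (forall u v, v \in A -> par u = Some v -> u \in A) ->
  {in A, forall v, a v <-> exists u, par u = Some v /\ x u} ->
  {in A, forall v, b v <-> exists u, par u = Some v /\ ~~ a u} ->
  {in A, forall v, x v = b v && ~~ a v} ->
  mim A (count x A).
Proof.
move=> U Hadj Hch Ha Hb Hx.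
have an u v : u \in A -> v \in A -> par u = Some v -> x u -> a v.
  by move=> uA vA Euv xu; apply/Ha => //; exists u.
split.
  pose w v := nth 0 A (find (fun u => (par u == Some v) && ~~ a u) A).
  have wP v : v \in A -> x v -> [/\ w v \in A, par (w v) = Some v & ~~ a (w v)].
    move=> vA xv; have : has (fun u => (par u == Some v) && ~~ a u) A.
      move: xv; rewrite Hx // => /andP[/Hb [//|u [Eu nu]] _].
      by apply/hasP; exists u; [apply: Hch Eu|rewrite Eu eqxx].
    move=> H; split; first by rewrite mem_nth // -has_find.
    - by have /andP[/eqP] := nth_find 0 H.
    - by have /andP[_] := nth_find 0 H.
  exists [seq (v, w v) | v <- filter x A]; rewrite size_map size_filter; split=> //.
  apply/im_inP; split.
  - move=> p /mapP [v]; rewrite mem_filter => /andP[xv vA] -> /=.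
    by have [wA Ew _] := wP v vA xv; rewrite Hadj // Ew eqxx orbT.
  - rewrite pairwise_map; have : pairwise (fun u v => u != v) (filter x A).
      by rewrite -uniq_pairwise filter_uniq.
    apply: (@sub_in_pairwise _ [in filter x A]); last exact/allP.
    move=> u v; rewrite !mem_filter => /andP[xu uA] /andP[xv vA] uv /=.
    have [wuA Eu nu] := wP u uA xu; have [wvA Ev nv] := wP v vA xv.
    have nau : ~~ a u by move: xu; rewrite Hx // => /andP[].
    have nav : ~~ a v by move: xv; rewrite Hx // => /andP[].
    have nxw t : t \in A -> x t -> ~~ x (w t).
      move=> tA xt; have [wtA Et nt] := wP t tA xt; apply/negP => xw.
      by move: xt; rewrite Hx // (an _ _ wtA tA Et xw) andbF.
    apply/apartP => y z; rewrite !inE /= => /orP[]/eqP-> /orP[]/eqP->; split.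
    - exact: uv.
    - rewrite Hadj //; apply/negP => /orP[]/eqP E; first by rewrite (an u v) in nav.
      by rewrite (an v u) in nau.
    - by apply/eqP => E; have := nxw v vA xv; rewrite -E xu.
    - rewrite Hadj //; apply/negP => /orP[]/eqP E; first by rewrite (an u (w v)) in nv.
      by move: E; rewrite Ev => -[E]; rewrite E eqxx in uv.
    - by apply/eqP => E; have := nxw u uA xu; rewrite E xv.
    - rewrite Hadj //; apply/negP => /orP[]/eqP E; last by rewrite (an v (w u)) in nu.
      by move: E; rewrite Eu => -[E]; rewrite E eqxx in uv.
    - by apply/eqP => E; move: Ev; rewrite -E Eu => -[E']; rewrite E' eqxx in uv.
    - rewrite Hadj // Eu Ev; apply/negP => /orP[]/eqP -[E].
        by have := nxw v vA xv; rewrite -E xu.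
      by have := nxw u uA xu; rewrite -E xv.
  - move=> p /mapP [v]; rewrite mem_filter => /andP[xv vA] -> /=.
    by have [] := wP v vA xv.
move=> M /im_inP [Ma Mp Mi].
pose touch (p : nat * nat) v :=
  x v && ((v \in [:: p.1; p.2]) || has (fun y => par v == Some y) [:: p.1; p.2]).
pose f p := nth 0 A (find (touch p) A).
(* Three cases for the edge from [u] to its parent [v]: [v] is marked; or a child of [v] is marked
   and its parent [v] is an end; or [v] is unmarked with no marked child, so [b v] fails and [u] has
   a marked child, whose parent [u] is an end. *)
have touchP u v : u \in A -> v \in A -> par u = Some v -> exists2 z, z \in A &
    x z && ((z \in [:: u; v]) || has (fun y => par z == Some y) [:: u; v]).
  move=> uA vA Eu; case xv : (x v); first by exists v => //; rewrite xv mem_seq2 eqxx orbT.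
  case av : (a v).
    move/Ha: av => /(_ vA) [z [Ez xz]]; exists z; first exact: Hch Ez.
    by rewrite xz /= Ez eqxx !orbT.
  have nb : ~~ b v by apply/negP => bv; rewrite Hx // bv av in xv.
  have au : a u.
    apply: contraNT nb => nau; apply/Hb => //; by exists u.
  move/Ha: au => /(_ uA) [z [Ez xz]]; exists z; first exact: Hch Ez.
  by rewrite xz /= Ez eqxx !orbT.
have fP p : p \in M -> f p \in A /\ touch p (f p).
  move=> pM; have [p1 p2] := Mi p pM.
  have H : has (touch p) A.
    apply/hasP; have := Ma p pM; rewrite Hadj // => /orP[]/eqP E.
      exact: touchP.
    have [z zA Hz] := touchP _ _ p2 p1 E; exists z => //; move: Hz.
    rewrite /touch !inE /= !orbF => /andP[-> /orP[]/orP[]->]; by rewrite ?orbT.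
  by split; [rewrite mem_nth // -has_find|exact: nth_find].
have Uf : uniq (map f M).
  rewrite uniq_pairwise pairwise_map.
  apply: (@sub_in_pairwise _ [in M] _ _ _ _ _ Mp); last exact/allP.
  move=> p q pM qM Hpq /=; apply/eqP => E.
  have [fA /andP[xf Tp]] := fP p pM; have [_ /andP[_ Tq]] := fP q qM.
  rewrite -E in Tq; set v := f p in fA xf Tp Tq.
  have T s : s \in M -> (v \in [:: s.1; s.2]) || has (fun y => par v == Some y) [:: s.1; s.2] ->
     exists2 y, y \in [:: s.1; s.2] & y \in A /\ (y = v \/ par v = Some y).
    move=> sM; have [s1 s2] := Mi s sM.
    have sA y : y \in [:: s.1; s.2] -> y \in A by rewrite !inE => /orP[]/eqP->.
    move=> /orP[Hv|/hasP [y Hy /eqP Ey]]; first by exists v; auto.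
    by exists y; auto.
  have [y Hy [yA Ey]] := T p pM Tp; have [z Hz [zA Ez]] := T q qM Tq.
  have [nyz] := (apartP _ _ Hpq) y z Hy Hz; rewrite Hadj //.
  case: Ey Ez => [Ey|Ey] [Ez|Ez].
  - by rewrite Ey Ez eqxx in nyz.
  - by rewrite Ey Ez eqxx.
  - by rewrite Ez Ey eqxx orbT.
  - by move: Ez; rewrite Ey => -[E']; rewrite E' eqxx in nyz.
rewrite -(size_map f) -size_filter; apply: uniq_leq_size Uf _ => v /mapP [p pM ->].
by have [fA /andP[xf _]] := fP p pM; rewrite mem_filter xf.
Qed.

Lemma mim_all A k : perm_eq A (iota 0 n) -> mim A k -> max_induced_matching n e k.
Proof.
move=> HA [[M [HM EM]] Hmax]; split.
  by exists M; split=> //; case/andP: HM.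
move=> M' HM'; apply: Hmax; apply/andP; split=> //; apply/allP => p pM.
have /andP[/allP /(_ p pM) Hp _] := HM'; have [p1 p2] := sg_lt Hp.
by rewrite !(perm_mem HA) !mem_iota p1 p2.
Qed.

End Matchings.

(** * Parsing the decomposition tree *)

(** Syntactic over-approximation of the registers written; for a concrete command, frame conditions
    then reduce to computation. *)
Fixpoint wregs (c : hcmd) : seq nat :=
  match c with
  | HConst r _ | HAdd r _ _ | HSub r _ _ | HLoad r _ _ => [:: r]
  | HSkip | HStore _ _ _ => [::]
  | HIf _ c d | HSeq c d => wregs c ++ wregs d
  end.

Fixpoint warrs (c : hcmd) : seq nat :=
  match c with
  | HStore j _ _ => [:: j]
  | HIf _ c d | HSeq c d => warrs c ++ warrs d
  | _ => [::]
  end.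

Lemma eval_rg c s r : r \notin wregs c -> rg (eval c s) r = rg s r.
Proof.
elim: c s => //= [r' k|r' a b|r' a b|r' j a|a c IHc d IHd|c IHc d IHd] s;
  rewrite ?eqb_eqn ?inE ?mem_cat ?negb_or; try by move/negbTE=> ->.
- by move=> /andP[/IHc Hc /IHd Hd]; case: ifP.
- by move=> /andP[/IHc Hc /IHd Hd]; rewrite Hd.
Qed.

Lemma eval_ar c s j : j \notin warrs c -> ar (eval c s) j = ar s j.
Proof.
elim: c s => //= [j' a b|a c IHc d IHd|c IHc d IHd] s;
  rewrite ?eqb_eqn ?inE ?mem_cat ?negb_or; try by move/negbTE=> ->.
- by move=> /andP[/IHc Hc /IHd Hd]; case: ifP.
- by move=> /andP[/IHc Hc /IHd Hd]; rewrite Hd.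
Qed.

Lemma iter_rg c s r k : r \notin wregs c -> rg (iter k (eval c) s) r = rg s r.
Proof. by move=> H; elim: k => //= k IH; rewrite eval_rg. Qed.

Lemma iter_ar c s j k : j \notin warrs c -> ar (iter k (eval c) s) j = ar s j.
Proof. by move=> H; elim: k => //= k IH; rewrite eval_ar. Qed.

(* Registers: 1 number n of vertices, 2 number of edges, 3 input position,
   4 set if the size of a leaf comes next, 5 vertices of the leaf still to be
   read, 6 node number, 10 current vertex, 11 its remaining neighbour, 12 label
   of the leaf being read, 13 constant 1, 14 iteration count, 15 scan position
   or stack height; 7, 8 and 9 are temporary.
   Arrays: 0 input, 1 label of a vertex, 2 kind of a node (as in enc_tree),
   3 value of a leaf, 4 degree of a vertex, 5 sum of its remaining neighbours
   (later the stack), 6 nonzero if some child is marked, 7 nonzero if some child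
   has no marked child. *)
Definition block (l : seq hcmd) : hcmd := foldr HSeq HSkip l.

(** Node numbers start at 1 to keep the label 0 free for complement leaves. Register 14 receives the
    input length minus [2 + 2 m], the number of tokens of the tree. *)
Definition parse_setup := block
  [:: HConst 13 1; HConst 8 0; HLoad 1 0 8; HLoad 2 0 13; HAdd 3 2 2;
      HAdd 3 3 13; HAdd 3 3 13; HSub 14 0 3; HConst 4 0; HConst 5 0; HConst 6 1].

(** An automaton consuming one token per iteration, with its state in registers 4 and 5. The
    truncated difference of a tag and 1 vanishes exactly for the binary nodes. A tree leaf gets the
    provisional value 0, to be increased by its marked vertices later. *)
Definition parse_step := block
  [:: HLoad 7 0 3; HAdd 3 3 13;
    HIf 5
      (HIf 4
        (block [:: HStore 2 6 7; HSub 8 7 13;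
           HIf 8 (HAdd 6 6 13) (HConst 4 1)])
        (block [:: HConst 4 0; HConst 5 0; HAdd 5 5 7; HLoad 8 2 6; HConst 9 2;
           HSub 8 8 9;
           HIf 8
             (block [:: HConst 12 0; HAdd 12 12 6; HStore 3 6 8])
             (block [:: HConst 12 0; HSub 7 7 9;
               HIf 7 (HStore 3 6 7) (HStore 3 6 13)]);
           HAdd 6 6 13]))
      (block [:: HStore 1 7 12; HSub 5 5 13])].

Definition count_edge := block
  [:: HLoad 8 4 9; HAdd 8 8 13; HStore 4 9 8;
      HLoad 8 4 10; HAdd 8 8 13; HStore 4 10 8;
      HLoad 8 5 9; HAdd 8 8 10; HStore 5 9 8;
      HLoad 8 5 10; HAdd 8 8 9; HStore 5 10 8].

(** Equality of labels is tested by two truncated subtractions that must both vanish. *)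
Definition edge_step := block
  [:: HLoad 9 0 3; HAdd 3 3 13; HLoad 10 0 3; HAdd 3 3 13;
    HLoad 7 1 9; HLoad 8 1 10;
    HIf 7 HSkip (block [:: HSub 11 7 8; HIf 11
      (block [:: HSub 11 8 7; HIf 11 count_edge HSkip]) HSkip])].

Definition advance := block [:: HAdd 15 15 13; HConst 10 0; HAdd 10 10 15].

Definition detach := block
  [:: HStore 4 10 8; HLoad 11 5 10;
      HLoad 8 4 11; HSub 8 8 13; HStore 4 11 8;
      HLoad 8 5 11; HSub 8 8 10; HStore 5 11 8].

(** The current vertex moves to the neighbour while the scan position in register 15 stays: the
    neighbour may just have become a leaf. *)
Definition propagate := block
  [:: HLoad 7 6 10;
      HIf 7 (block [:: HStore 7 11 13; HLoad 8 7 10; HIf 8 HSkip (HStore 6 11 13)])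
         HSkip;
      HConst 10 0; HAdd 10 10 11].

Definition peel_step := block
  [:: HLoad 8 4 10;
    HIf 8 advance (block [:: HSub 8 8 13;
     HIf 8 (block [:: detach; propagate]) advance])].

Definition count_step := block
  [:: HLoad 7 7 10;
    HIf 7 HSkip (block [:: HLoad 8 6 10;
      HIf 8 (block [:: HLoad 9 1 10; HLoad 8 3 9; HAdd 8 8 13; HStore 3 9 8]) HSkip]);
    HAdd 10 10 13].

(** For a join, the sum of one value and the truncated difference of the other with it is their
    maximum; a maximum 0 is replaced by 1. *)
Definition reduce_step := block
  [:: HSub 6 6 13; HLoad 7 2 6; HSub 8 7 13;
    HIf 8
      (block [:: HSub 15 15 13; HLoad 9 5 15; HSub 11 15 13; HLoad 10 5 11;
         HIf 7 (HAdd 9 9 10)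
           (block [:: HSub 8 9 10; HAdd 9 10 8; HIf 9 (HConst 9 1) HSkip]);
         HStore 5 11 9])
      (block [:: HLoad 8 3 6; HStore 5 15 8; HAdd 15 15 13])].

Arguments eval : simpl never.

Ltac run := lazy [eval block foldr setr seta rg ar Nat.eqb].
Ltac run_in H := lazy [eval block foldr setr seta rg ar Nat.eqb] in H.

Lemma parse_vertex s s' : s' = eval parse_step s -> rg s 13 = 1 -> 0 < rg s 5 ->
  let x := ar s 0 (rg s 3) in
  [/\ rg s' 3 = (rg s 3).+1, rg s' 5 = (rg s 5).-1,
      (rg s' 4 = rg s 4) * (rg s' 6 = rg s 6) * (rg s' 12 = rg s 12),
      ar s' 1 = upd (ar s 1) x (rg s 12)
    & (ar s' 2 = ar s 2) * (ar s' 3 = ar s 3)].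
Proof.
case: s => R A; rewrite /parse_step => Es'; run_in Es' => /= H1 H5.
move: Es'; rewrite (gtn_eqF H5) => ->; run.
by rewrite H1 addn1 subn1.
Qed.

Lemma parse_vertices l s s' k : s' = iter (size l) (eval parse_step) s ->
  rg s 13 = 1 -> rg s 5 = size l + k ->
  (forall i, i < size l -> ar s 0 (rg s 3 + i) = nth 0 l i) ->
  [/\ rg s' 3 = rg s 3 + size l, rg s' 5 = k,
      (rg s' 4 = rg s 4) * (rg s' 6 = rg s 6) * (rg s' 12 = rg s 12),
      forall v, ar s' 1 v = if v \in l then rg s 12 else ar s 1 v
    & (ar s' 2 = ar s 2) * (ar s' 3 = ar s 3)].
Proof.
elim: l s => [|x l IH] s; first by move=> -> /=; rewrite addn0; split.
rewrite [size _]/= iterSr => Es' H1 H5 Ht.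
have [|E3 E5 E Ea Er] := parse_vertex erefl H1; first by rewrite H5.
have [||| F3 F5 F Fa Fr] := IH _ Es'.
- by rewrite eval_rg.
- by rewrite E5 H5.
- move=> i Hi; rewrite E3 addSnnS eval_ar //; exact: (Ht i.+1).
rewrite F3 F5 !F !E !Fr !Er E3 addSnnS; split=> // v.
rewrite Fa !E Ea inE; have := Ht 0 isT; rewrite addn0 /= => ->.
by rewrite /upd; case: (v \in l); rewrite ?orbT ?orbF.
Qed.

Lemma parse_binary s s' : s' = eval parse_step s -> rg s 13 = 1 -> rg s 5 = 0 ->
  rg s 4 = 0 -> ar s 0 (rg s 3) <= 1 ->
  [/\ rg s' 3 = (rg s 3).+1, rg s' 4 = 0, rg s' 5 = 0, rg s' 6 = (rg s 6).+1
    & (ar s' 1 = ar s 1) * (ar s' 2 = upd (ar s 2) (rg s 6) (ar s 0 (rg s 3)))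
      * (ar s' 3 = ar s 3)].
Proof.
case: s => R A; rewrite /parse_step => Es'; run_in Es' => /= H1 H5 H4 Hx.
move: Es'; rewrite H5 H4 H1 subn_eq0 Hx /= => ->; run.
by rewrite ?H1 !addn1 H4 H5.
Qed.

Lemma parse_leaf_tag s s' : s' = eval parse_step s -> rg s 13 = 1 -> rg s 5 = 0 ->
  rg s 4 = 0 -> 1 < ar s 0 (rg s 3) ->
  [/\ rg s' 3 = (rg s 3).+1, rg s' 4 = 1, rg s' 5 = 0, rg s' 6 = rg s 6
    & (ar s' 1 = ar s 1) * (ar s' 2 = upd (ar s 2) (rg s 6) (ar s 0 (rg s 3)))
      * (ar s' 3 = ar s 3)].
Proof.
case: s => R A; rewrite /parse_step => Es'; run_in Es' => /= H1 H5 H4 Hx.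
move: Es'; rewrite H5 H4 H1 subn_eq0 leqNgt Hx /= => ->; run.
by rewrite ?H1 !addn1 H5.
Qed.

Lemma parse_leaf_size s s' (co : bool) : s' = eval parse_step s -> rg s 13 = 1 ->
  rg s 5 = 0 -> rg s 4 = 1 -> ar s 2 (rg s 6) = (if co then 3 else 2) ->
  [/\ rg s' 3 = (rg s 3).+1, rg s' 4 = 0, rg s' 5 = ar s 0 (rg s 3),
      (rg s' 6 = (rg s 6).+1) * (rg s' 12 = if co then 0 else rg s 6)
    & (ar s' 1 = ar s 1) * (ar s' 2 = ar s 2) *
      (ar s' 3 = upd (ar s 3) (rg s 6) (co && (2 < ar s 0 (rg s 3))))].
Proof.
case: s => R A; rewrite /parse_step => Es'; run_in Es' => /= H1 H5 H4 Hk.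
move: Es'; rewrite H5 H4 Hk /=; case: co {Hk} => /= [|->]; run; last first.
  by rewrite H1 !addn1 !add0n.
rewrite subn_eq0 ltnNge; case: leqP => Hx ->; run; rewrite H1 !addn1 !add0n //.
by move: Hx; rewrite -subn_eq0 => /eqP->.
Qed.

Fixpoint nnodes (T : dtree) : nat :=
  match T with
  | DLeaf _ _ => 1
  | DUnion l r | DJoin l r => (nnodes l + nnodes r).+1
  end.

Fixpoint nonempty_leaves (T : dtree) : bool :=
  match T with
  | DLeaf _ Sv => 0 < size Sv
  | DUnion l r | DJoin l r => nonempty_leaves l && nonempty_leaves r
  end.

(* The nodes are numbered in preorder, from k on; a vertex gets the number of
   its leaf as label, or 0 if that leaf is the complement of a tree. *)
Fixpoint parsed (T : dtree) (k : nat) (label kind value : nat -> nat) : Prop :=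
  match T with
  | DLeaf co Sv =>
      [/\ kind k = (if co then 3 else 2), value k = (co && (2 < size Sv))
        & {in Sv, forall v, label v = if co then 0 else k}]
  | DUnion l r => [/\ kind k = 0, parsed l k.+1 label kind value
                    & parsed r (k.+1 + nnodes l) label kind value]
  | DJoin l r => [/\ kind k = 1, parsed l k.+1 label kind value
                   & parsed r (k.+1 + nnodes l) label kind value]
  end.

(** Lets the description of the left subtree survive the parsing of the right one, which writes
    other labels and larger node numbers only. *)
Lemma parsed_eq T k f g h f' g' h' :
  {in dverts T, f =1 f'} ->
  (forall j, k <= j < k + nnodes T -> g j = g' j) ->
  (forall j, k <= j < k + nnodes T -> h j = h' j) ->
  parsed T k f g h -> parsed T k f' g' h'.
Proof.
have IH2 l r : (forall k, {in dverts l, f =1 f'} ->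
    (forall j, k <= j < k + nnodes l -> g j = g' j) ->
    (forall j, k <= j < k + nnodes l -> h j = h' j) ->
    parsed l k f g h -> parsed l k f' g' h') ->
  (forall k, {in dverts r, f =1 f'} ->
    (forall j, k <= j < k + nnodes r -> g j = g' j) ->
    (forall j, k <= j < k + nnodes r -> h j = h' j) ->
    parsed r k f g h -> parsed r k f' g' h') ->
  forall k, {in dverts l ++ dverts r, f =1 f'} ->
    (forall j, k <= j < k + (nnodes l + nnodes r).+1 -> g j = g' j) ->
    (forall j, k <= j < k + (nnodes l + nnodes r).+1 -> h j = h' j) ->
    [/\ g k = g' k, parsed l k.+1 f g h -> parsed l k.+1 f' g' h'
      & parsed r (k.+1 + nnodes l) f g h -> parsed r (k.+1 + nnodes l) f' g' h'].
  move=> IHl IHr k0 Hf Hg Hh; split; first by apply: Hg; lia.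
    apply: IHl => [v Hv|j Hj|j Hj]; [apply: Hf|apply: Hg|apply: Hh]; try lia.
    by rewrite mem_cat Hv.
  apply: IHr => [v Hv|j Hj|j Hj]; [apply: Hf|apply: Hg|apply: Hh]; try lia.
  by rewrite mem_cat Hv orbT.
elim: T k => [co Sv|l IHl r IHr|l IHl r IHr] k /= Hf Hg Hh.
- move=> [H1 H2 H3]; rewrite -Hg -?Hh; try lia.
  by split=> // v Hv; rewrite -Hf // H3.
- have [-> Hl Hr] := IH2 l r IHl IHr k Hf Hg Hh.
  by move=> [H1 /Hl ? /Hr ?].
- have [-> Hl Hr] := IH2 l r IHl IHr k Hf Hg Hh.
  by move=> [H1 /Hl ? /Hr ?].
Qed.

Definition tokens (s : state) (l : seq nat) : Prop :=
  forall i, i < size l -> ar s 0 (rg s 3 + i) = nth 0 l i.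

Lemma tokens_cat s l1 l2 : tokens s (l1 ++ l2) -> tokens s l1 /\
  (forall s', ar s' 0 = ar s 0 -> rg s' 3 = rg s 3 + size l1 -> tokens s' l2).
Proof.
move=> H; split=> [i Hi|s' E0 E3 i Hi].
  by rewrite H ?nth_cat ?Hi // size_cat ltn_addr.
rewrite E0 E3 -addnA H; last by rewrite size_cat ltn_add2l.
by rewrite nth_cat ltnNge leq_addr /= addKn.
Qed.

Definition parse_ready (s : state) : Prop :=
  [/\ rg s 13 = 1, rg s 5 = 0 & rg s 4 = 0].

(** The last conjunct is the frame condition that makes the induction compose: it protects what was
    parsed before this subtree. *)
Definition parse_spec (T : dtree) : Prop := forall s s',
  s' = iter (size (enc_tree T)) (eval parse_step) s -> parse_ready s ->
  tokens s (enc_tree T) -> uniq (dverts T) -> nonempty_leaves T ->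
  [/\ parse_ready s', rg s' 3 = rg s 3 + size (enc_tree T),
      rg s' 6 = rg s 6 + nnodes T,
      parsed T (rg s 6) (ar s' 1) (ar s' 2) (ar s' 3)
    & (forall v, v \notin dverts T -> ar s' 1 v = ar s 1 v) /\
      (forall j, j < rg s 6 -> ar s' 2 j = ar s 2 j /\ ar s' 3 j = ar s 3 j)].

Lemma parse_node s s' l r b : b <= 1 -> parse_spec l -> parse_spec r ->
  s' = iter (size (b :: enc_tree l ++ enc_tree r)) (eval parse_step) s ->
  parse_ready s -> tokens s (b :: enc_tree l ++ enc_tree r) ->
  uniq (dverts l ++ dverts r) -> nonempty_leaves l && nonempty_leaves r ->
  [/\ parse_ready s', rg s' 3 = rg s 3 + size (b :: enc_tree l ++ enc_tree r),
      rg s' 6 = rg s 6 + (nnodes l + nnodes r).+1,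
      [/\ ar s' 2 (rg s 6) = b,
          parsed l (rg s 6).+1 (ar s' 1) (ar s' 2) (ar s' 3)
        & parsed r ((rg s 6).+1 + nnodes l) (ar s' 1) (ar s' 2) (ar s' 3)]
    & (forall v, v \notin dverts l ++ dverts r -> ar s' 1 v = ar s 1 v) /\
      (forall j, j < rg s 6 -> ar s' 2 j = ar s 2 j /\ ar s' 3 j = ar s 3 j)].
Proof.
move=> Hb Hl Hr Es' [H1 H5 H4] Ht.
rewrite cat_uniq => /and3P[Ul /hasPn Ulr Ur] /andP[Nl Nr].
rewrite -cat1s in Ht; have [Ht0 {}Ht] := tokens_cat Ht.
have Eb : ar s 0 (rg s 3) = b by have := Ht0 0 isT; rewrite addn0.
rewrite [size _]/= size_cat iterSr addnC iterD in Es'.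
have [|E3 E4 E5 E6 [[Ea1 Ea2] Ea3]] := parse_binary erefl H1 H5 H4; first by rewrite Eb.
have E0 : ar (eval parse_step s) 0 = ar s 0 by rewrite eval_ar.
have E13 : rg (eval parse_step s) 13 = 1 by rewrite eval_rg.
set s1 := eval parse_step s in Es' E0 E13 E3 E4 E5 E6 Ea1 Ea2 Ea3.
have {}Ht : tokens s1 (enc_tree l ++ enc_tree r) by apply: Ht => //; rewrite E3 addn1.
clearbody s1; have [Htl {}Ht] := tokens_cat Ht.
have [|[F13 F5 F4] F3 F6 Fp [Fv Fj]] := Hl _ _ erefl _ Htl Ul Nl; first by [].
have F0 : ar (iter (size (enc_tree l)) (eval parse_step) s1) 0 = ar s1 0 by rewrite iter_ar.
set s2 := iter _ _ s1 in Es' F0 F13 F3 F4 F5 F6 Fp Fv Fj.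
have {}Ht : tokens s2 (enc_tree r) by apply: Ht.
clearbody s2.
have [|[G13 G5 G4] G3 G6 Gp [Gv Gj]] := Hr _ _ Es' _ Ht Ur Nr; first by [].
rewrite F6 E6 in Gp Gj; rewrite E6 in Fp Fj; split=> //.
- by rewrite G3 F3 E3 /= size_cat; lia.
- by rewrite G6 F6 E6; lia.
- split=> //.
  + by rewrite (Gj _ _).1 ?(Fj _ _).1 ?Ea2 ?Eb /upd ?eqxx //; lia.
  + apply: parsed_eq Fp => [v Hv|j Hj|j Hj].
    * by rewrite Gv //; apply: contraL Hv => /Ulr.
    * by rewrite (Gj _ _).1 //; lia.
    * by rewrite (Gj _ _).2 //; lia.
- split=> [v|j Hj].
    by rewrite mem_cat negb_or => /andP[vl vr]; rewrite Gv // Fv // Ea1.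
  have [-> ->] : ar s' 2 j = ar s2 2 j /\ ar s' 3 j = ar s2 3 j by apply: Gj; lia.
  have [-> ->] : ar s2 2 j = ar s1 2 j /\ ar s2 3 j = ar s1 3 j by apply: Fj; lia.
  by rewrite Ea2 Ea3 /upd ltn_eqF.
Qed.

Lemma parse_tree T : parse_spec T.
Proof.
elim: T => [co Sv|l IHl r IHr|l IHl r IHr] s s' Es' Hs Ht U N.
- have [H1 H5 H4] := Hs.
  have Hx : ar s 0 (rg s 3) = if co then 3 else 2.
    by have := Ht 0 isT; rewrite addn0.
  have Hk : ar s 0 (rg s 3).+1 = size Sv by have := Ht 1 isT; rewrite addn1.
  have {Ht} [_ Ht] := @tokens_cat s [:: if co then 3 else 2; size Sv] Sv Ht.
  rewrite [size _]/= -addn2 iterD [iter 2 _ _]/= in Es'.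
  have [|E3 E4 E5 E6 [[Ea1 Ea2] Ea3]] := parse_leaf_tag erefl H1 H5 H4.
    by rewrite Hx; case: (co).
  have E0 : ar (eval parse_step s) 0 = ar s 0 by rewrite eval_ar.
  have E13 : rg (eval parse_step s) 13 = 1 by rewrite eval_rg.
  set s1 := eval parse_step s in Es' E0 E13 E3 E4 E5 E6 Ea1 Ea2 Ea3; clearbody s1.
  have [|F3 F4 F5 [F6 F12] [[Fa1 Fa2] Fa3]] := @parse_leaf_size s1 _ co erefl E13 E5 E4.
    by rewrite Ea2 E6 /upd eqxx.
  have F0 : ar (eval parse_step s1) 0 = ar s1 0 by rewrite eval_ar.
  have F13 : rg (eval parse_step s1) 13 = 1 by rewrite eval_rg.
  set s2 := eval parse_step s1 in Es' F0 F13 F3 F4 F5 F6 F12 Fa1 Fa2 Fa3; clearbody s2.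
  have {}Ht : tokens s2 Sv by apply: Ht; rewrite ?F0 ?F3 ?E3 ?addn2.
  have [|G3 G5 [[G4 G6] G12] Ga1 [Ga2 Ga3]] := @parse_vertices Sv s2 s' 0 Es' F13 _ Ht.
    by rewrite F5 E0 E3 Hk addn0.
  split.
  + by split; rewrite ?G4 // Es' iter_rg.
  + by rewrite G3 F3 E3 /= !addSnnS.
  + by rewrite G6 F6 E6 addn1.
  + rewrite /= Ga2 Fa2 Ea2 Ga3 Fa3 E6 E0 E3 Hk Hx /upd eqxx; split=> // v Hv.
    by rewrite Ga1 Hv F12 E6.
  + split=> [v Hv|j Hj]; first by rewrite Ga1 (negbTE Hv) Fa1 Ea1.
    by rewrite Ga2 Fa2 Ea2 Ga3 Fa3 Ea3 E6 /upd ltn_eqF.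
- exact: (parse_node _ IHl IHr Es').
- exact: (parse_node _ IHl IHr Es').
Qed.

(** * Reading the edges and removing leaves *)

Definition good (f : nat -> nat) (q : nat * nat) : bool :=
  (f q.1 == f q.2) && (f q.1 != 0).

Lemma edge_step_ok s s' : s' = eval edge_step s -> rg s 13 = 1 ->
  let u := ar s 0 (rg s 3) in let v := ar s 0 (rg s 3).+1 in
  let g := good (ar s 1) (u, v) in
  [/\ rg s' 3 = (rg s 3).+2,
      forall w, ar s' 4 w = ar s 4 w + (if g then (u == w) + (v == w) else 0)
    & forall w, ar s' 5 w =
        ar s 5 w + (if g then (u == w) * v + (v == w) * u else 0)].
Proof.
case: s => R A; rewrite /edge_step /count_edge => Es'; run_in Es' => /= H1.
move: Es'; rewrite H1 !(addn1 (R 3)) !(addn1 (R 3).+1); set u := A 0 _; set v := A 0 _; rewrite /good /=.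
case: eqP => H0 Es'; first by rewrite Es' H0 andbF; run; split=> // w; rewrite addn0.
move: Es'; rewrite !subn_eq0 eqn_leq andbT; case: (leqP (A 1 u)) => L1; last first.
  by move=> ->; run; split=> // w; rewrite addn0.
case: leqP => L2 ->; last first.
  by run; split=> // w; rewrite addn0.
have Hup f h k w : upd (upd f u (f u + h)) v (upd f u (f u + h) v + k) w =
    f w + ((u == w) * h + (v == w) * k).
  rewrite /upd !(eq_sym w); case: (v =P w) => [->|_]; last first.
    by case: (u =P w) => [->|_]; rewrite ?mul1n ?mul0n ?addn0.
  by rewrite (eq_sym w); case: (u =P w) => [->|_]; rewrite ?mul1n ?mul0n ?addn0 ?addnA.
by run; split=> // w; rewrite Hup ?muln1.
Qed.

Definition flat (l : seq (nat * nat)) : seq nat := flatten [seq [:: p.1; p.2] | p <- l].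

Lemma edges_ok l s s' : s' = iter (size l) (eval edge_step) s -> rg s 13 = 1 ->
  tokens s (flat l) ->
  [/\ rg s' 3 = rg s 3 + (size l).*2,
      forall w, ar s' 4 w = ar s 4 w +
        \sum_(q <- l | good (ar s 1) q) ((q.1 == w) + (q.2 == w))
    & forall w, ar s' 5 w = ar s 5 w +
        \sum_(q <- l | good (ar s 1) q) ((q.1 == w) * q.2 + (q.2 == w) * q.1)].
Proof.
elim: l s => [|[u v] l IH] s.
  by move=> -> _ _; split=> [|w|w]; rewrite ?big_nil ?addn0.
rewrite [size _]/= iterSr => Es' H1 Ht.
have {Ht} [Ht1 Ht] := @tokens_cat s [:: u; v] (flat l) Ht.
have Eu : ar s 0 (rg s 3) = u by have := Ht1 0 isT; rewrite addn0.
have Ev : ar s 0 (rg s 3).+1 = v by have := Ht1 1 isT; rewrite addn1.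
have [E3 E4 E5] := edge_step_ok erefl H1.
have E0 : ar (eval edge_step s) 0 = ar s 0 by rewrite eval_ar.
have E1 : ar (eval edge_step s) 1 = ar s 1 by rewrite eval_ar.
have E13 : rg (eval edge_step s) 13 = 1 by rewrite eval_rg.
set s1 := eval edge_step s in Es' E0 E1 E13 E3 E4 E5; clearbody s1.
have [|F3 F4 F5] := IH _ Es' E13; first by apply: Ht => //; rewrite E3 addn2.
rewrite F3 E3; split=> [|w|w]; first by rewrite doubleS !addSnnS.
- by rewrite F4 E4 E1 big_cons Eu Ev; case: ifP; rewrite ?addn0 ?addnA.
- by rewrite F5 E5 E1 big_cons Eu Ev; case: ifP; rewrite ?addn0 ?addnA.
Qed.

Lemma sum_delta n w (F : nat -> nat) : w < n ->
  \sum_(u <- iota 0 n) (u == w) * F u = F w.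
Proof.
move=> Hw; rewrite (bigD1_seq w) ?mem_iota ?iota_uniq //= eqxx mul1n.
by rewrite big1 ?addn0 // => u /negbTE->.
Qed.

(** Each edge is listed once, with its smaller end first, but contributes to both ends. Taking [h]
    constantly 1 gives degrees, and the identity gives sums of neighbours. *)
Lemma sum_edge_list n e (f h : nat -> nat) w : w < n ->
  \sum_(q <- edge_list n e | good f q) ((q.1 == w) * h q.2 + (q.2 == w) * h q.1) =
  \sum_(v <- iota 0 n) (sg n e w v && good f (w, v)) * h v.
Proof.
move=> Hw; rewrite /edge_list big_filter_cond big_mkcond big_allpairs_dep /=.
pose c u v := [&& u < v, sg n e u v & good f (u, v)].
transitivity (\sum_(u <- iota 0 n) (\sum_(v <- iota 0 n) (v == w) * (c u v * h u) +
   (u == w) * \sum_(v <- iota 0 n) c u v * h v)).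
  apply: eq_bigr => u _; rewrite big_distrr -big_split; apply: eq_bigr => v _ /=.
  rewrite -andbA -/(c u v); case: (c u v) => /=; last by rewrite !mul0n !muln0.
  by rewrite !mul1n addnC.
rewrite big_split /= (sum_delta (fun u => \sum_(v <- iota 0 n) c u v * h v) Hw).
rewrite (eq_bigr (fun u => c u w * h u)) => [|u _]; last first.
  exact: (sum_delta (fun v => c u v * h u) Hw).
rewrite -big_split /=; apply: eq_bigr => v _; rewrite -mulnDl; congr (_ * _).
rewrite /c (sgC n e v w) /good /= (eq_sym (f v)).
case: (ltngtP v w) => [Hvw|Hvw|->]; rewrite ?sg_irr //=.
  by rewrite addn0; case: (sg n e w v) => //=; case: eqP => // ->.
Qed.

Lemma mem_edge_list n e q : q \in edge_list n e -> q.1 < n /\ q.2 < n.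
Proof. by rewrite mem_filter => /andP[/andP[_ /sg_lt]]. Qed.

Lemma sum_edge_list_ge n e (f h : nat -> nat) w : n <= w ->
  \sum_(q <- edge_list n e | good f q) ((q.1 == w) * h q.2 + (q.2 == w) * h q.1) = 0.
Proof.
move=> Hw; rewrite big1_seq // => q /andP[_ /mem_edge_list [H1 H2]].
by rewrite !ltn_eqF // ?(leq_trans H1) ?(leq_trans H2).
Qed.

Lemma advance_ok s s' : s' = eval advance s -> rg s 13 = 1 ->
  [/\ rg s' 15 = (rg s 15).+1, rg s' 10 = (rg s 15).+1
    & forall j, ar s' j = ar s j].
Proof. by case: s => R A -> /= H1; run; rewrite H1 add0n addn1. Qed.

Lemma detach_ok s s' : s' = eval detach s -> rg s 13 = 1 -> rg s 8 = 0 ->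
  let v := rg s 10 in let p := ar s 5 v in p != v ->
  [/\ rg s' 10 = v, rg s' 11 = p,
      forall w, ar s' 4 w = if w == v then 0 else ar s 4 w - (w == p),
      forall w, ar s' 5 w = ar s 5 w - (w == p) * v
    & (ar s' 6 = ar s 6) * (ar s' 7 = ar s 7)].
Proof.
case: s => R A -> /= H1 H8 Hpv; run; rewrite H1 H8; split=> // w.
  rewrite /upd (negbTE Hpv); case: (w =P A 5 (R 10)) => [->|_]; last by rewrite subn0.
  by rewrite (negbTE Hpv).
by rewrite /upd; case: (w =P A 5 (R 10)) => [->|_]; rewrite ?mul1n ?mul0n ?subn0.
Qed.

Lemma propagate_ok s s' : s' = eval propagate s -> rg s 13 = 1 ->
  let v := rg s 10 in let p := rg s 11 in p != v ->
  [/\ rg s' 10 = p,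
      (ar s' 4 = ar s 4) * (ar s' 5 = ar s 5),
      forall w, (ar s' 6 w != 0) =
        (ar s 6 w != 0) || [&& w == p, ar s 7 v != 0 & ar s 6 v == 0]
    & forall w, (ar s' 7 w != 0) = (ar s 7 w != 0) || (w == p) && (ar s 6 v == 0)].
Proof.
case: s => R A; rewrite /propagate => Es'; run_in Es' => /= H1 Hpv; move: Es'.
case: eqP => Hv; last first.
  by move=> ->; run; split=> // w; rewrite ?andbF ?orbF.
have -> : upd (A 7) (R 11) (R 13) (R 10) = A 7 (R 10).
  by rewrite /upd (eq_sym (R 10)) (negbTE Hpv).
rewrite H1.
case: (A 7 (R 10) =P 0) => Hb => ->; run; split=> // w; rewrite ?andbF ?orbF ?andbT //;
  by rewrite /upd; case: (w == R 11); rewrite ?orbT ?orbF.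
Qed.

(** Generalising the three subprograms in the proof keeps them folded while the equation is checked
    by computation. *)
Lemma eval_peel_step s : let d := ar s 4 (rg s 10) in
  let s1 := setr s 8 d in let s2 := setr s1 8 (d - rg s 13) in
  eval peel_step s = if d == 0 then eval advance s1 else
    if d - rg s 13 == 0 then eval propagate (eval detach s2) else eval advance s2.
Proof. by rewrite /peel_step; move: advance detach propagate. Qed.

Lemma peel_step_advance s s' : s' = eval peel_step s -> rg s 13 = 1 ->
  ar s 4 (rg s 10) != 1 ->
  [/\ rg s' 15 = (rg s 15).+1, rg s' 10 = (rg s 15).+1
    & forall j, ar s' j = ar s j].
Proof.
move=> Es' H1 Hd; move: Es'; rewrite eval_peel_step H1 subn_eq0.
case: eqP => H0; first by move=> /advance_ok; apply.
rewrite ifF; first by move=> /advance_ok; apply.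
by move: Hd; move/eqP: H0; case: (ar s 4 _) => [|[|]].
Qed.

Lemma peel_step_remove s s' : s' = eval peel_step s -> rg s 13 = 1 ->
  let v := rg s 10 in let p := ar s 5 v in
  ar s 4 v = 1 -> p != v ->
  [/\ (rg s' 15 = rg s 15) * (rg s' 10 = p),
      forall w, ar s' 4 w = if w == v then 0 else ar s 4 w - (w == p),
      forall w, ar s' 5 w = ar s 5 w - (w == p) * v,
      forall w, (ar s' 6 w != 0) =
        (ar s 6 w != 0) || [&& w == p, ar s 7 v != 0 & ar s 6 v == 0]
    & forall w, (ar s' 7 w != 0) = (ar s 7 w != 0) || (w == p) && (ar s 6 v == 0)].
Proof.
move=> Es' H1 v p Hd Hpv; move: Es'; rewrite eval_peel_step Hd H1 subnn /=.
set s0 := setr _ 8 0.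
have [E10 E11 E4 E5 [E6 E7]] := @detach_ok s0 _ erefl H1 erefl Hpv.
have E13 : rg (eval detach s0) 13 = 1 by rewrite eval_rg.
have E15 : rg (eval detach s0) 15 = rg s 15 by rewrite eval_rg.
set s1 := eval detach s0 in E13 E15 E10 E11 E4 E5 E6 E7 *; clearbody s1 => Es'.
have [|F10 [F4 F5] F6 F7] := propagate_ok Es' E13; first by rewrite E10 E11.
rewrite E10 E11 E6 E7 in F6; rewrite E10 E11 E6 E7 in F7; rewrite E11 in F10.
split=> //.
- by rewrite F10 Es' eval_rg.
- by move=> w; rewrite F4 E4.
- by move=> w; rewrite F5 E5.
Qed.

(** * Correctness of leaf removal *)

Section Peel.
Variables (n : nat) (F : rel nat).
Hypothesis Fsym : forall u v, F u v = F v u.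
Hypothesis Firr : forall u, F u u = false.
Hypothesis Flt : forall u v, F u v -> u < n /\ v < n.

Definition alive (par : nat -> option nat) : rel nat :=
  fun u v => [&& F u v, par u != Some v & par v != Some u].

Definition marked (s : state) (v : nat) : bool := (ar s 7 v != 0) && (ar s 6 v == 0).

(* [par u] is the vertex into which the removed vertex u was merged. *)
Record peeling (k : nat) (s : state) (par : nat -> option nat) : Prop := Peeling {
  peel_one : rg s 13 = 1;
  peel_par : forall u v, par u = Some v -> F u v;
  peel_deg : forall u, u < n -> ar s 4 u = \sum_(v <- iota 0 n) alive par u v;
  peel_ge : forall u, n <= u -> ar s 4 u = 0;
  peel_sum : forall u, u < n -> par u = None ->
    ar s 5 u = \sum_(v <- iota 0 n) alive par u v * v;
  peel_removed : forall u v, par u = Some v -> ar s 4 u = 0;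
  peel_a : forall v, ar s 6 v != 0 <-> exists u, par u = Some v /\ marked s u;
  peel_b : forall v, ar s 7 v != 0 <-> exists u, par u = Some v /\ ar s 6 u == 0;
  peel_time : rg s 15 + count par (iota 0 n) = k;
  peel_done : forall u, u <= rg s 15 -> u != rg s 10 -> ar s 4 u != 1;
  peel_cur : rg s 10 = rg s 15 \/ (rg s 10 < n /\ rg s 15 < n)
}.

Lemma aliveC par u v : alive par u v = alive par v u.
Proof. by rewrite /alive Fsym; case: (F v u) => //=; rewrite andbC. Qed.

(** The vertex exempted by [peel_done] does not have degree one, so everything up to the old scan
    position is settled and the exemption passes to the new one. *)
Lemma peel_advance k s par : peeling k s par -> ar s 4 (rg s 10) != 1 ->
  peeling k.+1 (eval peel_step s) par.
Proof.
move=> I Hd; have [E15 E10 Ea] := peel_step_advance erefl (peel_one I) Hd.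
have E13 : rg (eval peel_step s) 13 = rg s 13 by rewrite eval_rg.
case: I => I1 I2 I3 I3' I4 I5 I6 I7 I8 I9 I10.
split; rewrite ?E13 ?E15 ?E10 ?Ea // /marked ?Ea //.
- by rewrite addSn I8.
- move=> u Hu Hne; have Hi : u <= rg s 15 by rewrite -ltnS ltn_neqAle Hne.
  by case: (u =P rg s 10) => [->|/eqP] //; apply: I9.
- by left.
Qed.

(** The only remaining neighbour [p] equals the stored sum, and it is not yet removed since its
    degree is positive. Only the degree of [p] drops, possibly to one; it becomes the current vertex
    and is thereby exempt in [peel_done]. *)
Lemma peel_remove k s par : peeling k s par -> ar s 4 (rg s 10) = 1 ->
  exists par', peeling k.+1 (eval peel_step s) par'.
Proof.
move=> I Hd; have [I1 I2 I3 I3' I4 I5 I6 I7 I8 I9 I10] := I.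
set v := rg s 10 in Hd I9 I10.
have Hv : v < n by rewrite ltnNge; apply/negP => /I3'; rewrite Hd.
have Nv : par v = None by case E : (par v) => [w|] //; move: Hd; rewrite (I5 _ _ E).
have /sum_nat_seq_eq1 [p [Hp _ Ap Uq]] : \sum_(w <- iota 0 n) alive par v w = 1.
  by rewrite -I3.
have {Ap} Ap : alive par v p by case: (alive par v p) Ap.
have Hpn : p < n by rewrite mem_iota in Hp.
have {}Uq w : alive par v w -> w = p.
  move=> Aw; apply/eqP/negPn/negP => Hne.
  have Hw : w \in iota 0 n by move: Aw => /and3P[/Flt [_ Hw] _ _]; rewrite mem_iota.
  by have := Uq w Hne Hw isT; rewrite Aw.
have Fvp : F v p by case/and3P: Ap.
have Hpv : p != v by apply: contraTneq Fvp => ->; rewrite Firr.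
have Esum : ar s 5 v = p.
  rewrite I4 // (bigD1_seq p) ?iota_uniq //= Ap mul1n big1 ?addn0 // => w Hw.
  by case Aw : (alive par v w) => //; rewrite (Uq _ Aw) eqxx in Hw.
have Np : par p = None.
  case E : (par p) => [w|] //; have := I5 _ _ E; rewrite I3 // => /eqP.
  rewrite sum_nat_seq_eq0 => /allP /(_ v); rewrite mem_iota Hv => /(_ isT) /=.
  by rewrite aliveC Ap.
have [|[E15 E10] E4 E5 E6 E7] := peel_step_remove erefl I1 Hd; first by rewrite Esum.
rewrite -/v Esum in E10 E4 E5 E6 E7.
have E13 : rg (eval peel_step s) 13 = rg s 13 by rewrite eval_rg.
set s' := eval peel_step s in E13 E15 E10 E4 E5 E6 E7 *; clearbody s'.
pose par' u := if u == v then Some p else par u.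
(* The edge between [v] and [p] is the only one that dies, in both orientations. *)
have Aeq u w : alive par u w = alive par' u w + ((u == v) && (w == p) + (u == p) && (w == v)) :> nat.
  rewrite /alive /par'; case: (u =P v) => [->|/eqP Huv].
    rewrite (eq_sym v p) (negbTE Hpv) /= addn0.
    case: (w =P p) => [->|/eqP Hwp].
      by rewrite eqxx /= andbF; case/and3P: Ap => -> -> ->.
    have -> : (Some p == Some w) = false.
      by apply/eqP => -[E]; rewrite E eqxx in Hwp.
    rewrite /= addn0.
    case: (w =P v) => [->|_]; first by rewrite Firr.
    case Aw : (alive par v w); first by rewrite (Uq _ Aw) eqxx in Hwp.
    move: Aw; rewrite /alive Nv /=; by case: (F v w) => //= ->.
  rewrite /=; case: (w =P v) => [->|_]; last by rewrite andbF addn0.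
  rewrite andbT; case: (u =P p) => [->|/eqP Hup].
    by rewrite eqxx !andbF; move: Ap; rewrite aliveC /alive => ->.
  have -> : (Some p == Some u) = false.
    by apply/eqP => -[E]; rewrite E eqxx in Hup.
  by rewrite Nv addn0.
have sum_eq1 (h : nat -> nat) q : q < n -> \sum_(w <- iota 0 n) (w == q) * h w = h q.
  exact: sum_delta.
have Edeg u (h : nat -> nat) : u < n -> \sum_(w <- iota 0 n) alive par u w * h w =
    \sum_(w <- iota 0 n) alive par' u w * h w + ((u == v) * h p + (u == p) * h v).
  move=> Hu; rewrite -(sum_eq1 h p Hpn) -(sum_eq1 h v Hv) !big_distrr -!big_split.
  by apply: eq_bigr => w _ /=; rewrite Aeq !mulnDl -!mulnb !mulnA.
(* Only the flags of [p] change, and [p] is not removed ([Np]), so the invariants see unchanged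
   flags for every vertex that already has a parent. *)
have Emark u : u != p -> marked s' u = marked s u.
  move=> Hu; rewrite /marked; have := E6 u; have := E7 u.
  by rewrite (negbTE Hu) /= !orbF => -> /(congr1 negb); rewrite !negbK => ->.
have EA u : u != p -> (ar s' 6 u == 0) = (ar s 6 u == 0).
  move=> Hu; have := E6 u; rewrite (negbTE Hu) orbF => /(congr1 negb).
  by rewrite !negbK.
have Hvp : v != p by rewrite eq_sym.
have Hpar u w : par u = Some w -> (u != v) && (u != p).
  by move=> E; apply/andP; split; apply: contra_eq_neq E => ->; rewrite ?Nv ?Np.
exists par'; split.
- by rewrite E13.
- by move=> u w; rewrite /par'; case: eqP => [-> [<-]|_ /I2].
- move=> u Hu; rewrite E4; have := Edeg u (fun=> 1) Hu.
  under eq_bigr do rewrite muln1; under [in X in _ = X + _]eq_bigr do rewrite muln1.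
  rewrite -I3 // !muln1 => E; case: (u =P v) E => [->|_]; last by move=> ->; rewrite add0n addnK.
  by rewrite Hd (negbTE Hvp); lia.
- by move=> u Hu; rewrite E4 I3' // if_same.
- move=> u Hu; rewrite /par'; case: eqP => // /eqP Huv Nu.
  rewrite E5 I4 // Edeg // (negbTE Huv) add0n addnK //.
- move=> u w; rewrite /par' E4; case: eqP => // _ Hu.
  by rewrite (I5 _ _ Hu).
- move=> w; rewrite E6; split.
    case/orP=> [/I6 [u [Hu Mu]]|/and3P[/eqP -> H7 H6]].
      have /andP[Huv Hup] := Hpar _ _ Hu.
      by exists u; rewrite /par' (negbTE Huv) Emark.
    by exists v; rewrite /par' eqxx Emark // /marked H7.
  move=> [u []]; rewrite /par'; case: eqP => [-> [<-]|_ Hu].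
    by rewrite Emark // eqxx => /andP[-> ->]; rewrite orbT.
  have /andP[_ Hup] := Hpar _ _ Hu.
  by rewrite Emark // => Mu; apply/orP; left; apply/I6; exists u.
- move=> w; rewrite E7; split.
    case/orP=> [/I7 [u [Hu Mu]]|/andP[/eqP -> H6]].
      have /andP[Huv Hup] := Hpar _ _ Hu.
      by exists u; rewrite /par' (negbTE Huv) EA.
    by exists v; rewrite /par' eqxx EA.
  move=> [u []]; rewrite /par'; case: eqP => [-> [<-]|_ Hu].
    by rewrite EA // eqxx => ->; rewrite orbT.
  have /andP[_ Hup] := Hpar _ _ Hu.
  by rewrite EA // => Mu; apply/orP; left; apply/I7; exists u.
- have -> : count par' (iota 0 n) = (count par (iota 0 n)).+1.
    have Ev : v \in iota 0 n by rewrite mem_iota.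
    rewrite -!sum1_count !(big_mkcond (fun u => isSome _)) /=.
    rewrite !(bigD1_seq v) ?iota_uniq //= /par' eqxx Nv /= add0n add1n; congr _.+1.
    by apply: eq_bigr => u /negbTE ->.
  by rewrite E15 addnS I8.
- move=> u; rewrite E15 E10 E4 => Hu /negbTE Hup; rewrite Hup subn0.
  by case: (u =P v) => // /eqP; apply: I9.
- right; rewrite E10 E15; split=> //.
  by case: I10 => [<- //|[]].
Qed.

Lemma peel_steps k s par : peeling 0 s par ->
  exists par', peeling k (iter k (eval peel_step) s) par'.
Proof.
move=> I; elim: k => [|k [par' IH]]; first by exists par.
rewrite iterS; case: (ar (iter k (eval peel_step) s) 4 (rg (iter k (eval peel_step) s) 10) =P 1).
  exact: peel_remove IH.
by move=> /eqP /(peel_advance IH) ?; exists par'.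
Qed.

(* Among the vertices of A with an edge left, one of largest rank would have
   degree one. *)
Lemma peel_end s par (A : seq nat) : peeling (2 * n) s par ->
  treelike [in A] F -> (forall u v, u \in A -> F u v -> v \in A) ->
  {in A, forall u v, F u v = (par u == Some v) || (par v == Some u)}.
Proof.
move=> I [r Hr] HA.
have Hi : n <= rg s 15.
  have := count_size par (iota 0 n); rewrite size_iota; have := peel_time I; lia.
(* The exemption of the current vertex is harmless: by [peel_cur] it equals the scan position, which
   is at least [n], the other case being excluded by [Hi]. *)
have Hd u : u < n -> ar s 4 u != 1.
  move=> Hu; apply: (peel_done I); first exact: leq_trans (ltnW Hu) Hi.
  by case: (peel_cur I) => [->|[_ H]]; [rewrite ltn_eqF // (leq_trans Hu)|lia].
have Hal : {in A, forall u v, ~~ alive par u v}.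
  move=> u uA v; apply/negP => Auv.
  pose B := \max_(w <- A) r w.
  have HB w : w \in A -> r w <= B by move=> wA; apply: leq_bigmax_seq.
  have [m] := ubnP (B - r u); elim: m u v uA Auv => // m IH u v uA Auv Hm.
  have /and3P[Fuv _ _] := Auv; have [Hu Hv] := Flt Fuv.
  have Hnext w : alive par u w -> r u < r w -> False.
    move=> Auw Hr'; have /and3P[Fuw _ _] := Auw; have wA := HA _ _ uA Fuw.
    apply: (IH w u wA); first by rewrite aliveC.
    by have := HB w wA; lia.
  have : has (fun w => (w != v) && (alive par u w != 0 :> nat)) (iota 0 n).
    rewrite -sum_nat_seq_neq0; apply: contra (Hd u Hu) => /eqP E.
    rewrite (peel_deg I) // (bigD1_seq v) ?mem_iota ?iota_uniq //= E Auv.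
    by rewrite addn0.
  move=> /hasP [w _ /andP[Hwv]]; case Auw : (alive par u w) => // _.
  have /and3P[Fuw _ _] := Auw.
  case: (leqP (r v) (r u)) => [Lv|/(Hnext v Auv)] //.
  case: (leqP (r w) (r u)) => [Lw|/(Hnext w Auw)] //.
  move/eqP: Hwv; apply; apply: (Hr u) => //; exact: HA uA _.
move=> u uA v; have := Hal u uA v; rewrite /alive.
case Fuv : (F u v) => /=; first by rewrite negb_and !negbK => ->.
move=> _; apply/esym/negbTE/negP => /orP[]/eqP /(peel_par I); rewrite ?Fuv //.
by rewrite Fsym Fuv.
Qed.

End Peel.

(** * Evaluation of the decomposition tree *)

Lemma count_step_ok s s' : s' = eval count_step s -> rg s 13 = 1 ->
  let v := rg s 10 in rg s' 10 = v.+1 /\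
  forall w, ar s' 3 w = ar s 3 w + (marked s v && (ar s 1 v == w)).
Proof.
case: s => R A; rewrite /count_step /marked => Es'; run_in Es' => /= H1; move: Es'.
case: (A 7 (R 10) =P 0) => H7 /=.
  by move=> ->; run; rewrite H1 addn1; split=> // w; rewrite addn0.
case: (A 6 (R 10) =P 0) => H6 /= ->; run; rewrite H1 !addn1; split=> // w.
  by rewrite /upd eq_sym; case: (_ =P w) => [->|_]; rewrite ?addn1 ?addn0.
by rewrite addn0.
Qed.

Lemma count_ok k s s' : s' = iter k (eval count_step) s -> rg s 13 = 1 -> rg s 10 = 0 ->
  rg s' 10 = k /\ forall w, ar s' 3 w = ar s 3 w +
    count (fun v => marked s v && (ar s 1 v == w)) (iota 0 k).
Proof.
elim: k s' => [|k IH] s' -> H1 H0; first by rewrite H0; split=> // w; rewrite addn0.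
rewrite iterS; set s1 := iter k _ s.
have [E10 E3] := IH s1 erefl H1 H0.
have [|F10 F3] := @count_step_ok s1 _ erefl; first by rewrite /s1 iter_rg.
have Ea j : j != 3 -> ar s1 j = ar s j.
  by move=> Hj; rewrite /s1 iter_ar //= !inE.
rewrite F10 E10; split=> // w; rewrite F3 E3 E10 -addnA -(addn1 k) iotaD count_cat /=.
by rewrite /marked !Ea // addn0.
Qed.

Lemma reduce_step_leaf s s' : s' = eval reduce_step s -> rg s 13 = 1 -> 0 < rg s 6 ->
  1 < ar s 2 (rg s 6).-1 ->
  [/\ rg s' 6 = (rg s 6).-1, rg s' 15 = (rg s 15).+1
    & ar s' 5 = upd (ar s 5) (rg s 15) (ar s 3 (rg s 6).-1)].
Proof.
case: s => R A; rewrite /reduce_step => Es'; run_in Es' => /= H1 H6.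
move: Es'; rewrite H1 (subn1 (R 6)) subn_eq0 => Es' Hk.
by move: Es'; rewrite leqNgt Hk /= => ->; run; rewrite ?H1 ?addn1.
Qed.

Lemma reduce_step_node s s' : s' = eval reduce_step s -> rg s 13 = 1 -> 0 < rg s 6 ->
  ar s 2 (rg s 6).-1 <= 1 ->
  let x := ar s 5 (rg s 15).-1 in let y := ar s 5 (rg s 15).-2 in
  [/\ rg s' 6 = (rg s 6).-1, rg s' 15 = (rg s 15).-1
    & ar s' 5 = upd (ar s 5) (rg s 15).-2
        (if ar s 2 (rg s 6).-1 == 0 then x + y else maxn 1 (maxn y x))].
Proof.
case: s => R A; rewrite /reduce_step => Es'; run_in Es' => /= H1 H6.
move: Es'; rewrite H1 (subn1 (R 6)) subn_eq0 => Es' Hk.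
move: Es'; rewrite Hk !subn1 => ->.
case: (A 2 (R 6).-1 =P 0) => H0; run; first by [].
rewrite -maxnE; case: eqP => Hm; run; split=> //; congr upd.
  by rewrite Hm.
by move/eqP: Hm; rewrite -lt0n => /maxn_idPr ->.
Qed.

Section Evaluation.
Variables (n : nat) (e : rel nat).

Fixpoint valued (T : dtree) (k : nat) (kind value : nat -> nat) : Prop :=
  match T with
  | DLeaf _ Sv => 1 < kind k /\ mim n e Sv (value k)
  | DUnion l r => [/\ kind k = 0, valued l k.+1 kind value
                    & valued r (k.+1 + nnodes l) kind value]
  | DJoin l r => [/\ kind k = 1, valued l k.+1 kind value
                   & valued r (k.+1 + nnodes l) kind value]
  end.

Lemma size_dverts T : nonempty_leaves T -> 0 < size (dverts T).
Proof.
by elim: T => //= [l IHl r _|l IHl r _] /andP[/IHl Hl _]; rewrite size_cat addn_gt0 Hl.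
Qed.

Definition eval_spec (T : dtree) : Prop := forall s s' k,
  s' = iter (nnodes T) (eval reduce_step) s -> rg s 13 = 1 -> rg s 6 = k + nnodes T ->
  valued T k (ar s 2) (ar s 3) ->
  dtree_ok n e T -> uniq (dverts T) -> nonempty_leaves T ->
  [/\ rg s' 6 = k, rg s' 15 = (rg s 15).+1, mim n e (dverts T) (ar s' 5 (rg s 15))
    & forall i, i < rg s 15 -> ar s' 5 i = ar s 5 i].

(** Preorder read backwards visits the right subtree, then the left one, then the node. So the left
    value ends up on top of the stack, just above the right one. *)
Lemma eval_node s s' k l r : eval_spec l -> eval_spec r ->
  s' = iter (nnodes l + nnodes r).+1 (eval reduce_step) s -> rg s 13 = 1 ->
  rg s 6 = k + (nnodes l + nnodes r).+1 -> ar s 2 k <= 1 ->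
  valued l k.+1 (ar s 2) (ar s 3) -> valued r (k.+1 + nnodes l) (ar s 2) (ar s 3) ->
  dtree_ok n e l -> dtree_ok n e r -> uniq (dverts l ++ dverts r) ->
  nonempty_leaves l && nonempty_leaves r ->
  exists x y, [/\ rg s' 6 = k /\ rg s' 15 = (rg s 15).+1,
    mim n e (dverts l) x, mim n e (dverts r) y,
    ar s' 5 (rg s 15) = (if ar s 2 k == 0 then x + y else maxn 1 (maxn x y))
  & forall i, i < rg s 15 -> ar s' 5 i = ar s 5 i].
Proof.
move=> IHl IHr Es' H1 H6 Hk Vl Vr Dl Dr.
rewrite cat_uniq => /and3P[Ul _ Ur] /andP[Nl Nr].
move: Es'; rewrite iterS iterD.
have Hr6 : rg s 6 = (k.+1 + nnodes l) + nnodes r by rewrite H6; lia.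
have [E6 E15 Em Ei] := IHr s _ _ erefl H1 Hr6 Vr Dr Ur Nr.
have E13 : rg (iter (nnodes r) (eval reduce_step) s) 13 = 1 by rewrite iter_rg.
have E2 : ar (iter (nnodes r) (eval reduce_step) s) 2 = ar s 2 by rewrite iter_ar.
have E3 : ar (iter (nnodes r) (eval reduce_step) s) 3 = ar s 3 by rewrite iter_ar.
set s1 := iter _ _ s in E6 E15 Em Ei E13 E2 E3 *; clearbody s1.
rewrite -E2 -E3 in Vl.
have [F6 F15 Fm Fi] := IHl s1 _ _ erefl E13 E6 Vl Dl Ul Nl.
have F13 : rg (iter (nnodes l) (eval reduce_step) s1) 13 = 1 by rewrite iter_rg.
have F2 : ar (iter (nnodes l) (eval reduce_step) s1) 2 = ar s1 2 by rewrite iter_ar.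
set s2 := iter _ _ s1 in F6 F15 Fm Fi F13 F2 *; clearbody s2 => Es'.
have [||] := reduce_step_node Es' F13; rewrite ?F6 ?F2 ?E2 ?F15 ?E15 //= => G6 G15 G5.
rewrite E15 in Fm Fi.
exists (ar s2 5 (rg s 15).+1), (ar s1 5 (rg s 15)); rewrite G6 G15 G5.
have -> : ar s1 5 (rg s 15) = ar s2 5 (rg s 15) by rewrite Fi.
split=> //.
- by rewrite Fi.
- by rewrite /upd eqxx maxnC; case: ifP => // _; rewrite maxnC (maxnC (ar s2 5 _)).
- by move=> i Hi; rewrite /upd ltn_eqF // Fi ?Ei // ltnS ltnW.
Qed.

Lemma eval_tree T : eval_spec T.
Proof.
elim: T => [co Sv|l IHl r IHr|l IHl r IHr] s s' k Es' H1 H6.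
- move=> [Hk Hm] _ _ _.
  have Hp : (rg s 6).-1 = k by rewrite H6 /= addn1.
  have [||] := reduce_step_leaf Es' H1; rewrite ?Hp ?H6 /= ?addn1 // => -> -> ->.
  by split=> // [|i Hi]; rewrite /upd ?eqxx ?ltn_eqF.
- move=> [Hk Vl Vr] [Dl [Dr Hx]] U N.
  have [|x [y [[E6 E15] Hl Hr Es Ei]]] := eval_node IHl IHr Es' H1 H6 _ Vl Vr Dl Dr U N.
    by rewrite Hk.
  by split=> //=; rewrite Es Hk /=; apply: mim_union.
- move=> [Hk Vl Vr] [Dl [Dr Hx]] U N.
  have [|x [y [[E6 E15] Hl Hr Es Ei]]] := eval_node IHl IHr Es' H1 H6 _ Vl Vr Dl Dr U N.
    by rewrite Hk.
  have /andP[/size_dverts Nl /size_dverts Nr] := N.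
  by split=> //=; rewrite Es Hk /=; apply: mim_join.
Qed.

Lemma treelike_leaf Sv : is_tree (size Sv) (induced n e Sv) -> uniq Sv ->
  treelike [in Sv] (sg n e).
Proof.
move=> Ht U; apply: treelike_nth => //.
apply: treelike_eq (tree_treelike Ht) => i j Hi Hj.
rewrite !inE in Hi Hj; rewrite {1}/sg /induced [sg n e (nth 0 Sv j) _]sgC andbb Hi Hj /=.
by case: eqP => // ->; rewrite sg_irr.
Qed.

Lemma coadj_leaf Sv i j : uniq Sv -> i < size Sv -> j < size Sv ->
  sg (size Sv) (compl (induced n e Sv)) i j = coadj n e (nth 0 Sv i) (nth 0 Sv j).
Proof.
move=> U Hi Hj; rewrite /coadj nth_uniq // {1}/sg /compl /induced Hi Hj /=.
by rewrite ![sg n e (nth 0 Sv j) _]sgC !andbb.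
Qed.

Lemma mim_cotree_leaf Sv : is_tree (size Sv) (compl (induced n e Sv)) -> uniq Sv ->
  mim n e Sv (2 < size Sv).
Proof.
move=> Ht U; apply: mim_cotree => //.
  apply: treelike_nth => //; apply: treelike_eq (tree_treelike Ht) => i j Hi Hj.
  exact: coadj_leaf.
(* With two vertices, the only pair is an edge of the tree, hence not an edge of the graph. *)
move=> S2; have : sg (size Sv) (compl (induced n e Sv)) 0 1.
  by move: Ht; rewrite S2; apply: tree_size2.
rewrite coadj_leaf ?S2 // => /andP[_ Huv].
case: Sv S2 {Ht U} Huv => [|x [|y [|]]] //= _ Huv u v.
rewrite !inE => /orP[]/eqP-> /orP[]/eqP->; rewrite ?sg_irr //.
by rewrite sgC.
Qed.

(** * Values of the leaves from labels and marks *)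

Variables (label : nat -> nat) (s : state) (par : nat -> option nat).
Let F : rel nat := fun u v => sg n e u v && good label (u, v).
Hypothesis Hpeel : peeling n F (2 * n) s par.

Lemma label_range T k kind value v : parsed T k label kind value ->
  v \in dverts T -> label v = 0 \/ k <= label v < k + nnodes T.
Proof.
elim: T k => [co Sv|l IHl r IHr|l IHl r IHr] k /=.
- by move=> [_ _ H] /H ->; case: (co); [left|right; lia].
- move=> [_ Hl Hr]; rewrite mem_cat => /orP[/(IHl _ Hl)|/(IHr _ Hr)]; lia.
- move=> [_ Hl Hr]; rewrite mem_cat => /orP[/(IHl _ Hl)|/(IHr _ Hr)]; lia.
Qed.

Lemma label_split l r k kind value : parsed l k.+1 label kind value ->
  parsed r (k.+1 + nnodes l) label kind value ->
  (forall v, v < n -> k <= label v < k + (nnodes l + nnodes r).+1 ->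
     v \in dverts l ++ dverts r) ->
  (forall v, v < n -> k.+1 <= label v < k.+1 + nnodes l -> v \in dverts l) /\
  (forall v, v < n -> k.+1 + nnodes l <= label v < k.+1 + nnodes l + nnodes r ->
     v \in dverts r).
Proof.
move=> Hl Hr H; split=> v Hv Hlab; have := H v Hv; rewrite mem_cat.
  move=> /(_ ltac:(lia)) /orP[//|/(label_range Hr)]; lia.
move=> /(_ ltac:(lia)) /orP[/(label_range Hl)|//]; lia.
Qed.

Lemma Fsym u v : F u v = F v u.
Proof.
by rewrite /F sgC /good /= (eq_sym (label u)); congr (_ && _); case: eqP => // ->.
Qed.

Lemma Firr u : F u u = false.
Proof. by rewrite /F sg_irr. Qed.

Lemma Flt u v : F u v -> u < n /\ v < n.
Proof. by move=> /andP[/sg_lt]. Qed.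

(** Vertices labelled in the range of a subtree lie in that subtree; at a tree leaf this makes the
    count collected under its number the number of its marked vertices, to which [mim_tree] applies.
    It also closes the leaf under [F], as [peel_end] requires. *)
Lemma valued_parsed T k kind value value' : 0 < k ->
  parsed T k label kind value ->
  (forall w, value' w = value w +
     count (fun v => marked s v && (label v == w)) (iota 0 n)) ->
  (forall v, v < n -> k <= label v < k + nnodes T -> v \in dverts T) ->
  {in dverts T, forall v, v < n} -> dtree_ok n e T -> uniq (dverts T) ->
  valued T k kind value'.
Proof.
move=> Hk Hp Hv; elim: T k Hk Hp => [co Sv|l IHl r IHr|l IHl r IHr] k Hk.
- move=> [K V Lab] /= Hin Hlt Hok U; split; first by rewrite K; case: (co).
  have {}Hin v : v < n -> label v = k -> v \in Sv.
    by move=> Hvn E; apply: Hin => //; rewrite E leqnn addn1 /=.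
  rewrite Hv V; case: co Hok Lab {K V} => /= Hok Lab.
    (* A vertex labelled [k] would lie in this complement leaf, whose vertices have label 0, while
       [k] is positive. *)
    rewrite (_ : count _ _ = 0) ?addn0; first exact: mim_cotree_leaf.
    apply/eqP; rewrite -leqn0 leqNgt -has_count; apply/hasP => -[v].
    rewrite mem_iota /= => Hvn /andP[_ /eqP E].
    by have := Lab v (Hin v Hvn E); rewrite E; lia.
  rewrite add0n (_ : count _ _ = count (marked s) Sv); last first.
    rewrite -[RHS]size_filter -size_filter; apply: perm_size; apply: uniq_perm.
    - by rewrite filter_uniq ?iota_uniq.
    - by rewrite filter_uniq.
    - move=> v; rewrite !mem_filter mem_iota /= -andbA; congr (_ && _).
      apply/andP/idP => [[/eqP E Hvn]|Hvs]; first exact: Hin.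
      by rewrite Lab // eqxx Hlt.
  have EF : {in Sv &, F =2 sg n e}.
    by move=> u v Hu Hv'; rewrite /F /good /= !Lab // eqxx -lt0n Hk !andbT.
  have HA u v : u \in Sv -> F u v -> v \in Sv.
    move=> Hu /andP[/sg_lt [_ Hvn] /andP[/eqP /= E _]].
    by apply: Hin => //; rewrite -E Lab.
  have TF : treelike [in Sv] F.
    apply: (treelike_eq (f := sg n e)); last exact: treelike_leaf.
    by move=> u v Hu Hv'; rewrite EF.
  have HF := peel_end Fsym Flt Hpeel TF HA.
  apply: (@mim_tree n e Sv par (marked s) (fun v => ar s 6 v != 0)
    (fun v => ar s 7 v != 0)) => //.
  + by move=> u v Hu Hv'; rewrite -EF // HF.
  + by move=> u v Hv' /(peel_par Hpeel); rewrite Fsym => /(HA _ _ Hv').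
  + by move=> v _; apply: (peel_a Hpeel).
  + move=> v _; split=> [/(peel_b Hpeel) [u [Eu Hu]]|[u [Eu Hu]]].
      by exists u; rewrite negbK.
    by apply/(peel_b Hpeel); exists u; rewrite negbK in Hu.
  + by move=> v _; rewrite /marked negbK.
- move=> [K Hl Hr] /= /(label_split Hl Hr) [Hinl Hinr] Hlt [Dl [Dr _]].
  rewrite cat_uniq => /and3P[Ul _ Ur]; split=> //.
    by apply: IHl => // v Hv'; apply: Hlt; rewrite mem_cat Hv'.
  by apply: IHr => // v Hv'; apply: Hlt; rewrite mem_cat Hv' orbT.
- move=> [K Hl Hr] /= /(label_split Hl Hr) [Hinl Hinr] Hlt [Dl [Dr _]].
  rewrite cat_uniq => /and3P[Ul _ Ur]; split=> //.
    by apply: IHl => // v Hv'; apply: Hlt; rewrite mem_cat Hv'.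
  by apply: IHr => // v Hv'; apply: Hlt; rewrite mem_cat Hv' orbT.
Qed.

End Evaluation.

(** * The program *)

Definition edge_setup := HConst 3 2.
(* An iteration of peel_step removes a vertex or moves the scan to the next
   one, so 2 n iterations suffice. *)
Definition peel_setup := block [:: HConst 15 0; HConst 10 0; HAdd 14 1 1].
Definition count_setup := HConst 10 0.
Definition reduce_setup := block [:: HConst 15 0; HSub 14 6 13].
Definition result := block [:: HConst 8 0; HLoad 7 5 8].

Definition prog : hprog :=
  PSeq (PCmd parse_setup) (PSeq (PLoop 14 parse_step) (
  PSeq (PCmd edge_setup) (PSeq (PLoop 2 edge_step) (
  PSeq (PCmd peel_setup) (PSeq (PLoop 14 peel_step) (
  PSeq (PCmd count_setup) (PSeq (PLoop 1 count_step) (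
  PSeq (PCmd reduce_setup) (PSeq (PLoop 14 reduce_step) (PCmd result)))))))))).

Lemma cost_cmd c q s : cost (PSeq (PCmd c) q) s = csize c + cost q (eval c s).
Proof. by []. Qed.

Lemma cost_loop r c q s : cost (PSeq (PLoop r c) q) s =
  3 + rg s r * (csize c + 4) + cost q (iter (rg s r) (eval c) s).
Proof. by []. Qed.

Lemma size_flat l : size (flat l) = (size l).*2.
Proof. by elim: l => //= q l IH; rewrite IH. Qed.

Lemma size_enc_tree T : size (dverts T) + nnodes T <= size (enc_tree T).
Proof. by elim: T => [co Sv|l IHl r IHr|l IHl r IHr] /=; rewrite ?size_cat; lia. Qed.

Lemma dtree_ok_nonempty n e T : dtree_ok n e T -> nonempty_leaves T.
Proof.
elim: T => [co Sv|l IHl r IHr|l IHl r IHr] /=.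
- by case: co => -[[]].
- by move=> [/IHl -> [/IHr ->]].
- by move=> [/IHl -> [/IHr ->]].
Qed.

Section Correctness.
Variables (n : nat) (e : rel nat) (T : dtree) (s0 : state).
Hypothesis HT : decomposition_tree n e T.
Let input := encode n e T.
Let m := size (edge_list n e).
Hypothesis Hlen : rg s0 0 = size input.
Hypothesis Harr : forall j i, j < 8 -> ar s0 j i = if j == 0 then nth 0 input i else 0.

Let inputE : input = [:: n; m] ++ (flat (edge_list n e) ++ enc_tree T).
Proof. by rewrite /input /encode /enc_graph. Qed.

Let size_input : size input = 2 + m.*2 + size (enc_tree T).
Proof. by rewrite inputE /= size_cat size_flat. Qed.

Let HU : uniq (dverts T).
Proof. by case: HT => H _; rewrite (perm_uniq H) iota_uniq. Qed.

Let HN : nonempty_leaves T.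
Proof. by case: HT => _ /dtree_ok_nonempty. Qed.

Let Hlt : {in dverts T, forall v, v < n}.
Proof. by case: HT => H _ v; rewrite (perm_mem H) mem_iota. Qed.

Let Hin v : v < n -> v \in dverts T.
Proof. by case: HT => H _ Hv; rewrite (perm_mem H) mem_iota. Qed.

Let s1 := eval parse_setup s0.
Let s2 := iter (rg s1 14) (eval parse_step) s1.
Let s3 := eval edge_setup s2.
Let s4 := iter (rg s3 2) (eval edge_step) s3.
Let s5 := eval peel_setup s4.
Let s6 := iter (rg s5 14) (eval peel_step) s5.
Let s7 := eval count_setup s6.
Let s8 := iter (rg s7 1) (eval count_step) s7.
Let s9 := eval reduce_setup s8.
Let s10 := iter (rg s9 14) (eval reduce_step) s9.

Lemma result_reg s : rg (eval result s) 7 = ar s 5 0.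
Proof. by []. Qed.

Lemma peval_prog : peval prog s0 = eval result s10.
Proof. exact: erefl. Qed.

Lemma parse_setup_ok : [/\ parse_ready s1, rg s1 1 = n, rg s1 2 = m,
  rg s1 3 = 2 + m.*2 & rg s1 14 = size (enc_tree T) /\ rg s1 6 = 1].
Proof.
have E0 : ar s0 0 0 = n by rewrite Harr.
have E1 : ar s0 0 1 = m by rewrite Harr.
rewrite /s1 /parse_ready; move: Hlen E0 E1; rewrite size_input; case: (s0) => R A /= HL E0 E1; run.
rewrite E0 E1 HL; split=> //; try split=> //; lia.
Qed.

Lemma arr1 j : ar s1 j = ar s0 j.
Proof. by rewrite /s1 eval_ar. Qed.

Lemma tokens_input s : ar s 0 = ar s1 0 -> 
  (rg s 3 = 2 -> tokens s (flat (edge_list n e))) /\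
  (rg s 3 = 2 + m.*2 -> tokens s (enc_tree T)).
Proof.
move=> Ea.
(* A fictitious state with read position 0 sees the whole input, which [tokens_cat] can then cut at
   the required positions. *)
have H : tokens (setr s 3 0) ([:: n; m] ++ (flat (edge_list n e) ++ enc_tree T)).
  by move=> i _ /=; rewrite Ea arr1 Harr // add0n inputE.
have [_ H1] := tokens_cat H; split=> E3.
  by have [] := tokens_cat (H1 s erefl E3).
have [_ H2] := tokens_cat (H1 (setr s 3 2) erefl erefl).
by apply: H2 => //; rewrite size_flat.
Qed.

Lemma parse_ok : [/\ rg s2 6 = 1 + nnodes T,
  parsed T 1 (ar s2 1) (ar s2 2) (ar s2 3)
  & rg s2 13 = 1 /\ ((rg s2 1 = n) * (rg s2 2 = m))].
Proof.
have [R E1 E2 E3 [E14 E6]] := parse_setup_ok.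
have [_ /(_ E3) Ht] := tokens_input (erefl (ar s1 0)).
have [|[F13 _ _] _ F6 Fp _] := @parse_tree T s1 s2 _ R Ht HU HN.
  by rewrite /s2 E14.
by rewrite F6 E6 in Fp *; split=> //; rewrite /s2 !iter_rg.
Qed.

Let F : rel nat := fun u v => sg n e u v && good (ar s2 1) (u, v).

Lemma edges_counted : [/\ forall u, u < n -> ar s4 4 u = \sum_(v <- iota 0 n) F u v,
  forall u, n <= u -> ar s4 4 u = 0
  & forall u, u < n -> ar s4 5 u = \sum_(v <- iota 0 n) F u v * v].
Proof.
have [_ _ [E13 [E1 E2]]] := parse_ok.
have Ea j : ar s3 j = ar s2 j by rewrite /s3 eval_ar.
have Er r : r != 3 -> rg s3 r = rg s2 r by move=> Hr; rewrite /s3 eval_rg // inE.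
have [/(_ erefl) Ht _] := @tokens_input s3 ltac:(by rewrite Ea /s2 iter_ar).
have [||_ E4 E5] := @edges_ok (edge_list n e) s3 s4 _ _ Ht.
- by rewrite /s4 Er // E2.
- by rewrite Er.
have Z j w : 3 < j < 8 -> ar s3 j w = 0.
  move=> Hj; rewrite Ea /s2 iter_ar; last by move: Hj; do 8![case: j => [|j] //].
  by rewrite arr1 Harr; [case: j Hj | case/andP: Hj].
split=> u Hu.
- rewrite E4 Z // Ea add0n; have := sum_edge_list e (ar s2 1) (fun=> 1) Hu.
  under eq_bigr do rewrite !muln1; move=> ->.
  by apply: eq_bigr => v _; rewrite muln1.
- rewrite E4 Z // Ea add0n; have := sum_edge_list_ge e (ar s2 1) (fun=> 1) Hu.
  by under eq_bigr do rewrite !muln1.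
- by rewrite E5 Z // Ea add0n; apply: (sum_edge_list e (ar s2 1) id Hu).
Qed.

Lemma peel_start : peeling n F 0 s5 (fun=> None).
Proof.
have [_ _ [E13 [E1 E2]]] := parse_ok.
have [D4 Dge D5] := edges_counted.
have Ea j : ar s5 j = ar s4 j by rewrite /s5 eval_ar.
have Z j w : 5 < j < 8 -> ar s5 j w = 0.
  move=> Hj; have Hj' : j \notin warrs edge_step /\ j \notin warrs parse_step.
    by split; move: Hj; do 8![case: j => [|j] //].
  rewrite Ea /s4 iter_ar; last by case: Hj'.
  rewrite /s3 eval_ar // /s2 iter_ar; last by case: Hj'.
  by rewrite arr1 Harr; [case: j Hj {Hj'} | case/andP: Hj].
have E15 : rg s5 15 = 0 by [].
have E10 : rg s5 10 = 0 by [].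
split; rewrite ?Ea ?E15 ?E10 //.
- by rewrite /s5 eval_rg // /s4 iter_rg // /s3 eval_rg.
- by move=> u Hu; rewrite D4 //; apply: eq_bigr => v _; rewrite /alive !andbT.
- by move=> u Hu _; rewrite D5 //; apply: eq_bigr => v _; rewrite /alive !andbT.
- by move=> v; rewrite -Ea Z //; split=> // -[u []].
- by move=> v; rewrite -Ea Z //; split=> // -[u []].
- by rewrite add0n; elim: (iota 0 n).
- by move=> [|].
- by left.
Qed.

Lemma all_counted : exists par, peeling n F (2 * n) s6 par /\
  forall w, ar s8 3 w = ar s2 3 w +
    count (fun v => marked s6 v && (ar s2 1 v == w)) (iota 0 n).
Proof.
have [_ _ [E13 [E1 E2]]] := parse_ok.
have E14 : rg s5 14 = 2 * n.
  have -> : rg s5 14 = rg s4 1 + rg s4 1 by [].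
  by rewrite /s4 iter_rg // /s3 eval_rg // E1; lia.
have Fs u v : F u v = F v u := Fsym _ _ _ _ _.
have [par Hpar] := peel_steps Fs (@Firr n e (ar s2 1)) (@Flt n e (ar s2 1)) (2 * n) peel_start.
exists par; split; first by rewrite /s6 E14.
have [|||_ E3] := @count_ok n s7 s8.
- rewrite /s8 (_ : rg s7 1 = n) //.
  by rewrite /s7 eval_rg // /s6 iter_rg // /s5 eval_rg // /s4 iter_rg // /s3 eval_rg.
- by rewrite /s7 eval_rg // /s6 iter_rg // /s5 eval_rg // /s4 iter_rg // /s3 eval_rg.
- by [].
move=> w; rewrite E3; have Ea j : ar s7 j = ar s6 j by rewrite /s7 eval_ar.
have Eb j : j \in [:: 1; 3] -> ar s6 j = ar s2 j.
  by rewrite !inE => /orP[]/eqP->; rewrite /s6 iter_ar // /s5 eval_ar // /s4 iter_ar // /s3 eval_ar.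
by rewrite /marked !Ea (Eb 1) // (Eb 3).
Qed.

Lemma result_ok : max_induced_matching n e (rg (peval prog s0) 7).
Proof.
rewrite peval_prog result_reg.
have [E6 Hp [E13 [E1 E2]]] := parse_ok.
have [par [Hpar E3]] := all_counted.
have [Hperm Hok] := HT.
have Hval := valued_parsed Hpar (ltnSn 0) Hp E3 (fun v Hv _ => Hin Hv) Hlt Hok HU.
have F6 : rg s8 6 = 1 + nnodes T.
  by rewrite /s8 iter_rg // /s7 eval_rg // /s6 iter_rg // /s5 eval_rg // /s4 iter_rg // /s3 eval_rg.
have F13 : rg s8 13 = 1.
  by rewrite /s8 iter_rg // /s7 eval_rg // /s6 iter_rg // /s5 eval_rg // /s4 iter_rg // /s3 eval_rg.
have G14 : rg s9 14 = nnodes T.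
  have -> : rg s9 14 = rg s8 6 - rg s8 13 by [].
  by rewrite F6 F13 addKn.
have K2 : ar s8 2 = ar s2 2.
  by rewrite /s8 iter_ar // /s7 eval_ar // /s6 iter_ar // /s5 eval_ar // /s4 iter_ar // /s3 eval_ar.
have [||||_ _ Hm _] := @eval_tree n e T s9 s10 1 _ _ _ _ Hok HU HN.
- by rewrite /s10 G14.
- by rewrite /s9 eval_rg.
- by rewrite /s9 eval_rg.
- rewrite /s9 !eval_ar // K2; exact: Hval.
exact: mim_all Hperm Hm.
Qed.

(** With [a] tokens and [b] nodes in the tree encoding, the loops take about 78 [a], 102 [m], 200
    [n], 45 [n] and 61 [b] steps. Since [n + b <= a] and the input has [2 + 2 m + a] entries, 400 is
    a generous factor. *)
Lemma cost_ok : cost prog s0 <= 400 * size input + 400.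
Proof.
have [_ _ E1' E2' [E14 _]] := parse_setup_ok.
have [E6 _ [E13 [E1 E2]]] := parse_ok.
have L1 : rg s3 2 = m by rewrite /s3 eval_rg.
have L2 : rg s5 14 = n + n.
  have -> : rg s5 14 = rg s4 1 + rg s4 1 by [].
  by rewrite /s4 iter_rg // /s3 eval_rg // E1.
have L3 : rg s7 1 = n.
  by rewrite /s7 eval_rg // /s6 iter_rg // /s5 eval_rg // /s4 iter_rg // /s3 eval_rg.
have L4 : rg s9 14 = nnodes T.
  have -> : rg s9 14 = rg s8 6 - rg s8 13 by [].
  have Er r : r \in [:: 6; 13] -> rg s8 r = rg s2 r.
    by rewrite !inE => /orP[]/eqP->;
      rewrite /s8 iter_rg // /s7 eval_rg // /s6 iter_rg // /s5 eval_rg // /s4 iter_rg // /s3 eval_rg.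
  by rewrite !Er // E6 E13 addKn.
rewrite /prog !(cost_cmd, cost_loop) -/s1 -/s2 -/s3 -/s4 -/s5 -/s6 -/s7 -/s8 -/s9.
rewrite E14 L1 L2 L3 L4 size_input.
have Hn : size (dverts T) = n by case: HT => /perm_size -> _; rewrite size_iota.
have := size_enc_tree T; rewrite Hn.
move: (size (enc_tree T)) (nnodes T) => a b Hab.
have -> : cost (PCmd result) _ = 8 by [].
have -> : csize parse_setup = 23 by []. have -> : csize edge_setup = 1 by [].
have -> : csize peel_setup = 3 by []. have -> : csize count_setup = 1 by [].
have -> : csize reduce_setup = 2 by []. have -> : csize parse_step = 74 by [].
have -> : csize edge_step = 98 by []. have -> : csize peel_step = 96 by [].
have -> : csize count_step = 41 by []. have -> : csize reduce_step = 57 by [].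
by rewrite -muln2; lia.
Qed.

End Correctness.

Definition epilogue : seq instr := [:: IConst 1 0; IAdd 0 (loc 7) 1; IHalt].

Lemma code_at_mid (l1 l2 l3 : seq instr) : code_at (l1 ++ l2 ++ l3) (size l1) l2.
Proof.
by move=> i Hi; rewrite nth_cat ltnNge leq_addr /= addKn nth_cat Hi.
Qed.

Theorem theorem5 :
  exists (P : seq instr) (c : nat),
    forall (n : nat) (e : rel nat) (T : dtree),
      tree_cograph n e -> decomposition_tree n e T ->
      exists t k, t <= c * size (encode n e T) + c /\
                  runs_to P (encode n e T) t k /\ max_induced_matching n e k.
Proof.
(* The 600 covers [400 L + 400] for the program, [11 L + 100] for the relocation and 2 steps at the
   end, for input length [L]. The prologue has 66 instructions. *)
exists (prologue ++ pcompile prog 66 ++ epilogue), 600 => n e T _ HT.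
(* The compiled code is kept as a variable, so that no later step unfolds it. *)
have [code Ec] : exists code, code = pcompile prog 66 by eexists.
rewrite -Ec; set P := prologue ++ _.
have size_prologue : size prologue = 66 by [].
have C0 : code_at P 0 prologue := @code_at_mid [::] prologue (code ++ epilogue).
have C1 : code_at P 66 code by rewrite -size_prologue; apply: code_at_mid.
have C2 : code_at P (66 + size code) epilogue.
  have := @code_at_mid (prologue ++ code) epilogue [::].
  by rewrite cats0 -catA size_cat size_prologue.
clearbody P.
have Hin : 0 < size (encode n e T) by [].
have [t0 [m0 [s0 [Ht0 R0 rep0 HL Ha]]]] := prologue_ok Hin C0.
have HX : 20 <= 32 * size (encode n e T) by move: (size _) Hin => L; lia.
rewrite Ec in C1.
have [//|t1 [m1 [Ht1 R1 [_ /(_ 7 isT) Hreg _]]]] := pcompile_ok HX _ C1 rep0.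
have Hmax := result_ok HT HL Ha; rewrite -Hreg in Hmax.
rewrite -{}Ec in R1; have [Ce Ch] := @code_at_cat _ _ [:: IConst 1 0; IAdd 0 (loc 7) 1] [:: IHalt] C2.
have [{}Ch _] := code_at_cons Ch.
have R2 := runs_straight m1 Ce isT.
have [E Hs] := runs_trans R0 (runs_trans R1 R2).
exists (t0 + (t1 + 2)), (m1 (loc 7)); split; last split => //.
- move: (cost_ok HT HL Ha) Ht0 Ht1; move: (size _) (cost _ _) => L k; lia.
- split; [|split=> //].
  + by rewrite E /halted /= Ch.
  + by rewrite E /= /upd /= addn0.
Qed.
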